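(* Let $(\mu_n)$ be an SI-martingale on $\mathbb{R}^d$, let $\{\eta_t\}_{t\in\Gamma}$ be a family of finite Borel measures on $\mathbb{R}^d$ indexed by a totally bounded metric space $\Gamma$, and write $Y_n^t=\int\mu_n\,d\eta_t$. Suppose there are constants $s,\alpha,C>0$ such that: (H2) $\eta_t(B(x,r))\le Cr^s$ for all $x\in\mathbb{R}^d$, $t\in\Gamma$, $0<r<1$; (H3) almost surely $\mu_n(x)\le C2^{\alpha n}$ for all $n,x$; (H5) there is $\theta>0$ such that for every $\xi>0$ there exist families $\Gamma_n\subset\Gamma$ with at most $\exp(C_\xi 2^{n\xi})$ elements (for some constant $C_\xi$) and an a.s. finite random variable $N_0\in\mathbb{N}$ such that $$\sup_{t\in\Gamma}Y_n^t\le\sup_{t\in\Gamma_n}Y_n^t+o(2^{\theta n})\quad\text{for all }n\ge N_0.$$ Suppose further that $0\le\alpha-s<\theta$. Then, almost surely, $$\sup_{n\in\mathbb{N},\,t\in\Gamma}2^{-\theta n}Y_n^t<\infty.$$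
   Context: An SI-martingale on $\mathbb{R}^d$ is a sequence $(\mu_n)_{n\ge0}$ of random functions $\mu_n:\mathbb{R}^d\to[0,\infty)$ (identified with the measures $\mu_n(x)\,dx$) such that: (SI1) $\mu_0$ is a deterministic bounded function with bounded support; (SI2) there is an increasing filtration $(\mathcal{B}_n)$ with $\mu_n$ $\mathcal{B}_n$-measurable and $\mathbb{E}(\mu_{n+1}(x)\mid\mathcal{B}_n)=\mu_n(x)$ for all $x$, $n$; (SI3) there is $C<\infty$ with $\mu_{n+1}(x)\le C\mu_n(x)$ for all $x,n$; (SI4) there is $C<\infty$ such that for any $(C2^{-n})$-separated family $\mathcal{Q}$ of half-open dyadic cubes of side length $2^{-(n+1)}$, the restrictions $\{\mu_{n+1}|_Q\}_{Q\in\mathcal{Q}}$ are independent conditionally on $\mathcal{B}_n$. *)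

(* Defs.v *)
From HB Require Import structures.
From mathcomp Require Import all_boot all_order all_algebra.
From mathcomp Require Import all_classical all_reals all_analysis.
Set Implicit Arguments. Unset Strict Implicit. Unset Printing Implicit Defensive.
Import Order.TTheory GRing.Theory Num.Theory.
Import numFieldNormedType.Exports.
Local Open Scope classical_set_scope.
Local Open Scope ring_scope.

(* Points of R^d are d-tuples of reals; [d.-tuple R] carries the product of
   the Borel sigma-algebras of R, i.e. the Borel sigma-algebra of R^d. *)

Section defs.
Variable R : realType.

Definition sqdist {d : nat} (x y : d.-tuple R) : R :=
  \sum_(i < d) (tnth x i - tnth y i) ^+ 2.

Definition eball {d : nat} (x : d.-tuple R) (r : R) : set (d.-tuple R) :=
  [set y | sqdist x y < r ^+ 2].

Definition dyadic_cube {d : nat} (m : nat) (k : 'I_d -> int) : set (d.-tuple R) :=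
  [set y | forall i : 'I_d,
     (k i)%:~R / 2 ^+ m <= tnth y i /\ tnth y i < ((k i)%:~R + 1) / 2 ^+ m].

Definition separated_cubes {d : nat} (delta : R) (m : nat)
    (K : set ('I_d -> int)) : Prop :=
  forall k k', K k -> K k' -> k <> k' ->
    forall x y, dyadic_cube m k x -> dyadic_cube m k' y -> delta ^+ 2 <= sqdist x y.

Definition sub_measurable {T : Type} (G : set (set T)) (f : T -> R) : Prop :=
  forall A : set R, measurable A -> G (f @^-1` A).

Section prob.
Context {d0 : measure_display} {Omega : measurableType d0}.
Variable P : probability Omega R.

Definition filtration (B : nat -> set (set Omega)) : Prop :=
  forall n, sigma_algebra setT (B n) /\ B n `<=` measurable /\ B n `<=` B n.+1.

Definition cond_prob_version (G : set (set Omega)) (A : set Omega)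
    (Y : Omega -> R) : Prop :=
  sub_measurable G Y /\ (forall w, 0 <= Y w) /\
  forall E, G E -> (\int[P]_(w in E) (Y w)%:E = P (E `&` A))%E.

(* The sigma-algebras F i (i in K) are independent conditionally on G:
   for every finite family of distinct indices i_1..i_m in K and events
   A_i in F i, P(A_i1 & ... & A_im | G) = prod_j P(A_ij | G) a.s.,
   expressed through versions of the conditional probabilities. *)
Definition cond_indep {I : eqType} (G : set (set Omega))
    (F : I -> set (set Omega)) (K : set I) : Prop :=
  forall (s : seq I), uniq s -> (forall i, i \in s -> K i) ->
  forall A : I -> set Omega, (forall i, i \in s -> F i (A i)) ->
  exists Y : I -> Omega -> R,
    (forall i, i \in s -> cond_prob_version G (A i) (Y i)) /\
    forall E, G E ->
      P (E `&` \bigcap_(i in [set j | j \in s]) A i) =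
      (\int[P]_(w in E) (\prod_(i <- s) Y i w)%:E)%E.

Definition restr_sigma {d : nat} (f : Omega -> d.-tuple R -> R)
    (Q : set (d.-tuple R)) : set (set Omega) :=
  <<s [set E | exists x, exists A : set R,
               [/\ Q x, measurable A & E = (fun w => f w x) @^-1` A]] >>.

Definition SI_martingale {d : nat} (mu : nat -> Omega -> d.-tuple R -> R) : Prop :=
  (forall n w x, 0 <= mu n w x) /\
  (forall n, measurable_fun [set: Omega * d.-tuple R] (fun p => mu n p.1 p.2)) /\
  (exists f : d.-tuple R -> R,
     (forall w x, mu 0%N w x = f x) /\
     (exists M : R, forall x, f x <= M) /\
     (exists K : R, forall x, (exists i, K < `|tnth x i|) -> f x = 0)) /\
  (exists B : nat -> set (set Omega),
     filtration B /\
     (forall n x, sub_measurable (B n) (fun w => mu n w x)) /\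
     (forall n x E, B n E ->
        (\int[P]_(w in E) (mu n.+1 w x)%:E = \int[P]_(w in E) (mu n w x)%:E)%E) /\
     (exists C : R, forall n (K : set ('I_d -> int)),
        separated_cubes (C / 2 ^+ n) n.+1 K ->
        cond_indep (B n) (fun k => restr_sigma (mu n.+1) (dyadic_cube n.+1 k)) K)) /\
  (exists C : R, forall n w x, mu n.+1 w x <= C * mu n w x).

End prob.

Definition totally_bounded (T : pseudoMetricType R) : Prop :=
  forall e : R, 0 < e -> exists s : seq T, forall t, exists2 u, u \in s & ball u e t.

End defs.

(* Main.v *)
(* Fix n and t. Cut R^d into the dyadic cubes Q of side 2^-(n+1) and colour them
   with boundedly many colours so that equally coloured cubes are far apart.
   Given B_n, the masses X_Q of mu_(n+1) eta_t on cubes of one colour are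
   independent, with conditional means m_Q (the masses of mu_n eta_t), and (H2),
   (H3) give 0 <= X_Q <= b with b of order 2^((alpha - s) n). By convexity
   exp(rho x / b) <= 1 + c x on [0, b] for c = (exp rho - 1) / b, while
   1 + c m <= exp(c m); so, with S and m the sums of the X_Q and m_Q over one
   colour, E exp(rho S / b - c m) <= 1, and Markov's inequality gives
   P(S >= q m + u) <= exp(- rho u / b) as soon as exp rho - 1 <= q rho. Choose
   rho so small that q < 2^theta and u = 2^(theta (n+1)): a union bound over the
   colours and over Gamma_(n+1) followed by Borel-Cantelli yields, almost surely
   for large n, sup_t Y_(n+1)^t <= q sup_t Y_n^t + O(2^(theta n)), and
   2^(- theta n) sup_t Y_n^t stays bounded because q < 2^theta. *)
Require Import Defs.
From HB Require Import structures.
From mathcomp Require Import all_boot all_order all_algebra.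
From mathcomp Require Import all_classical all_reals all_analysis.
From mathcomp Require Import measurable_realfun ring lra.
Set Implicit Arguments. Unset Strict Implicit. Unset Printing Implicit Defensive.
Import Order.TTheory GRing.Theory Num.Theory.
Import numFieldNormedType.Exports.
Local Open Scope classical_set_scope.
Local Open Scope ring_scope.

(** * Multipliers: nonnegative functions that preserve equality of conditional expectations *)

Section multipliers.
Context {d1 : measure_display} {T : measurableType d1} {R : realType}.
Context (P : {sigma_finite_measure set T -> \bar R}).
Implicit Types (G : set (set T)) (U V phi : T -> R).

(** Encodes E(U | G) = E(V | G) without forming a conditional expectation. The integrals are
    extended reals, so for nonnegative functions integrability never has to be checked, and [G] may
    be a mere pi-system. *)
Definition same_integrals G U V :=
  forall A, G A ->
    (\int[P]_w (\1_A w * U w)%:E = \int[P]_w (\1_A w * V w)%:E)%E.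

(* A [G]-multiplier behaves like a function measurable with respect to the
   completion of [G]: unlike sub_measurable, this survives integration over a
   parameter (see multiplier_integral), which is what the masses of the
   random measures require. *)
Definition multiplier G phi :=
  [/\ measurable_fun [set: T] phi, (forall w, 0 <= phi w) &
      forall U V, measurable_fun [set: T] U -> measurable_fun [set: T] V ->
        (forall w, 0 <= U w) -> (forall w, 0 <= V w) ->
        same_integrals G U V ->
        same_integrals G (fun w => phi w * U w) (fun w => phi w * V w)].


Lemma multiplierM G phi psi :
  multiplier G phi -> multiplier G psi ->
  multiplier G (fun w => phi w * psi w).
Proof.
move=> [mp p0 Hp] [mq q0 Hq]; split.
- exact: measurable_funM.
- by move=> w; rewrite mulr_ge0.
- move=> U V mU mV U0 V0 UV A GA.
  under eq_integral do rewrite -(mulrA (phi _)).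
  under [RHS]eq_integral do rewrite -(mulrA (phi _)).
  apply: Hp => //.
  + exact: measurable_funM.
  + exact: measurable_funM.
  + by move=> w; rewrite mulr_ge0.
  + by move=> w; rewrite mulr_ge0.
  + exact: Hq.
Qed.

Context (G : set (set T)) (mG : G `<=` measurable).

Lemma measurable_indicM A U : G A -> measurable_fun [set: T] U ->
  measurable_fun [set: T] (fun w => (\1_A w * U w)%:E).
Proof.
move=> /mG mA mU; apply/measurable_EFinP; apply: measurable_funM => //.
Qed.

Lemma multiplier_cst (c : R) : 0 <= c -> multiplier G (cst c).
Proof.
move=> c0; split => // U V mU mV U0 V0 UV A GA.
under eq_integral do rewrite /cst mulrCA EFinM.
under [RHS]eq_integral do rewrite /cst mulrCA EFinM.
rewrite !ge0_integralZl_EFin ?UV//; try exact: measurable_indicM.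
- by move=> w _; rewrite lee_fin mulr_ge0.
- by move=> w _; rewrite lee_fin mulr_ge0.
Qed.

Lemma multiplierD phi psi :
  multiplier G phi -> multiplier G psi ->
  multiplier G (fun w => phi w + psi w).
Proof.
move=> [mp p0 Hp] [mq q0 Hq]; split.
- exact: measurable_funD.
- by move=> w; rewrite addr_ge0.
- move=> U V mU mV U0 V0 UV A GA.
  under eq_integral do rewrite mulrDl mulrDr EFinD.
  under [RHS]eq_integral do rewrite mulrDl mulrDr EFinD.
  rewrite !ge0_integralD//.
  + by rewrite (Hp U V)// (Hq U V).
  all: try by move=> w _; rewrite lee_fin !mulr_ge0.
  all: by apply: measurable_indicM => //; exact: measurable_funM.
Qed.

Lemma multiplier_prod (I : eqType) (s : seq I) (phi : I -> T -> R) :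
  (forall i, i \in s -> multiplier G (phi i)) ->
  multiplier G (fun w => \prod_(i <- s) phi i w).
Proof.
elim: s => [|i s IH] Hphi.
  by under eq_fun do rewrite big_nil; exact: multiplier_cst.
under eq_fun do rewrite big_cons.
apply: multiplierM; first by apply: Hphi; rewrite mem_head.
by apply: IH => j js; apply: Hphi; rewrite inE js orbT.
Qed.

Lemma multiplier_exp phi n : multiplier G phi ->
  multiplier G (fun w => phi w ^+ n).
Proof.
move=> Hphi; elim: n => [|n IH]; first exact: multiplier_cst.
by under eq_fun do rewrite exprS; exact: multiplierM.
Qed.

Lemma multiplier_indic A : (forall B, G B -> G (A `&` B)) -> measurable A ->
  multiplier G \1_A.
Proof.
move=> GI mA; split => // U V mU mV U0 V0 UV B GB.
have E (W : T -> R) w : \1_B w * (\1_A w * W w) = \1_(A `&` B) w * W w.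
  by rewrite indicI/= mulrCA mulrA.
under eq_integral do rewrite E.
under [RHS]eq_integral do rewrite E.
exact: UV (GI _ GB).
Qed.

Lemma measurable_integral_param (d2 : measure_display) (T2 : measurableType d2)
    (nu : {sigma_finite_measure set T2 -> \bar R}) (f : T * T2 -> R) phi :
  measurable_fun [set: T * T2] f -> (forall p, 0 <= f p) ->
  (forall w, (\int[nu]_y (f (w, y))%:E = (phi w)%:E)%E) ->
  measurable_fun [set: T] phi.
Proof.
move=> mf f0 fphi; apply/measurable_EFinP.
rewrite (_ : _ \o _ = fubini_F nu (EFin \o f)); last first.
  by apply/funext => w; rewrite /fubini_F/= fphi.
apply: measurable_fun_fubini_tonelli_F; first exact/measurable_EFinP.
by move=> p; rewrite lee_fin.
Qed.

Lemma integral_param_mul (d2 : measure_display) (T2 : measurableType d2)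
    (nu : {sigma_finite_measure set T2 -> \bar R}) (f : T * T2 -> R)
    phi (h : T -> R) :
  measurable_fun [set: T * T2] f -> (forall p, 0 <= f p) ->
  (forall w, (\int[nu]_y (f (w, y))%:E = (phi w)%:E)%E) ->
  measurable_fun [set: T] h -> (forall w, 0 <= h w) ->
  (\int[P]_w (h w * phi w)%:E =
   \int[nu]_y \int[P]_w (h w * f (w, y))%:E)%E.
Proof.
move=> mf f0 fphi mh h0.
rewrite -(fubini_tonelli (fun p => (h p.1 * f p)%:E)).
- apply: eq_integral => w _ /=.
  rewrite EFinM -fphi -ge0_integralZl_EFin//.
  + by move=> y _; rewrite lee_fin.
  + by apply/measurable_EFinP; exact: measurableT_comp.
- apply/measurable_EFinP; apply: measurable_funM => //.
  exact: (measurableT_comp mh measurable_fst).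
- by move=> p; rewrite lee_fin mulr_ge0.
Qed.

(** By Tonelli the integral over [w] is taken first with [y] frozen, so the property is only asked
    of each section [f (w, y)] in [w]; joint measurability of [f] with respect to [G] never
    enters. *)
Lemma multiplier_integral (d2 : measure_display) (T2 : measurableType d2)
    (nu : {sigma_finite_measure set T2 -> \bar R}) (f : T * T2 -> R) phi :
  measurable_fun [set: T * T2] f -> (forall p, 0 <= f p) ->
  (forall w, (\int[nu]_y (f (w, y))%:E = (phi w)%:E)%E) ->
  (forall y, multiplier G (fun w => f (w, y))) ->
  multiplier G phi.
Proof.
move=> mf f0 fphi Hf.
have phi0 w : 0 <= phi w.
  by rewrite -lee_fin -fphi integral_ge0// => y _; rewrite lee_fin.
split => //; first exact: (measurable_integral_param _ _ fphi).
move=> U V mU mV U0 V0 UV A GA.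
have E (W : T -> R) w : \1_A w * (phi w * W w) = (\1_A w * W w) * phi w.
  by rewrite mulrA mulrAC.
under eq_integral do rewrite E.
under [RHS]eq_integral do rewrite E.
have mA (W : T -> R) : measurable_fun [set: T] W ->
    measurable_fun [set: T] (fun w => \1_A w * W w).
  by move=> mW; apply/measurable_EFinP; exact: measurable_indicM.
have A0 (W : T -> R) : (forall w, 0 <= W w) -> forall w, 0 <= \1_A w * W w.
  by move=> W0 w; rewrite mulr_ge0.
rewrite (integral_param_mul mf f0 fphi (mA _ mU) (A0 _ U0)).
rewrite (integral_param_mul mf f0 fphi (mA _ mV) (A0 _ V0)).
apply: eq_integral => y _; have [_ _ /(_ U V mU mV U0 V0 UV A GA)] := Hf y.
under eq_integral do rewrite (mulrC (f _)) mulrA.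
by under [RHS]eq_integral do rewrite (mulrC (f _)) mulrA.
Qed.

(** Monotone convergence exchanges the sum with both integrals, so the termwise identities add
    up. *)
Lemma multiplier_series (f : nat -> T -> R) phi :
  (forall w, (\sum_(n <oo) (f n w)%:E = (phi w)%:E)%E) ->
  (forall n, multiplier G (f n)) ->
  multiplier G phi.
Proof.
move=> fphi Hf.
have mf n : measurable_fun [set: T] (f n) by have [] := Hf n.
have f0 n w : 0 <= f n w by have [] := Hf n.
have mphi : measurable_fun [set: T] phi.
  apply/measurable_EFinP.
  rewrite (_ : _ \o _ = fun w => (\sum_(n <oo) (f n w)%:E)%E).
    apply: ge0_emeasurable_sum => //.
      by move=> n w _ _; rewrite lee_fin.
    by move=> n _; exact/measurable_EFinP.
  by apply/funext => w /=; rewrite fphi.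
have phi0 w : 0 <= phi w.
  by rewrite -lee_fin -fphi nneseries_ge0// => n _; rewrite lee_fin.
have swap U A : measurable_fun [set: T] U -> (forall w, 0 <= U w) -> G A ->
  (\int[P]_w (\1_A w * (phi w * U w))%:E =
   \sum_(n <oo) \int[P]_w (\1_A w * (f n w * U w))%:E)%E.
  move=> mU U0 GA; rewrite -integral_nneseries//.
  - apply: eq_integral => w _.
    rewrite mulrCA EFinM muleC -fphi -nneseriesZl => [|n _]; last by rewrite lee_fin.
    by apply: eq_eseriesr => n _ /=; rewrite -EFinM mulrAC -mulrA.
  - by move=> n; apply: measurable_indicM => //; exact: measurable_funM.
  - by move=> n w _; rewrite lee_fin !mulr_ge0.
split => // U V mU mV U0 V0 UV A GA.
rewrite (swap U A mU U0 GA) (swap V A mV V0 GA); apply: eq_eseriesr => n _.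
by have [_ _] := Hf n; exact.
Qed.

(** The exponential series has nonnegative coefficients, so for nonnegative [phi] each of its terms
    is a multiplier. *)
Lemma multiplier_expR phi : multiplier G phi -> multiplier G (expR \o phi).
Proof.
move=> Hphi; have phi0 w : 0 <= phi w by have [] := Hphi.
apply: (@multiplier_series (fun n w => n`!%:R^-1 * phi w ^+ n)) => [w|n].
- transitivity (limn (EFin \o (series (exp_coeff (phi w))))).
    congr (limn _); apply/funext => n /=; rewrite /series/= -sumEFin.
    by apply: eq_bigr => i _; rewrite /exp_coeff/= mulrC.
  by rewrite EFin_lim//; exact: is_cvg_series_exp_coeff.
- apply: multiplierM; last exact: multiplier_exp.
  by apply: multiplier_cst; rewrite invr_ge0.
Qed.

(* Layer cake: phi is the integral of the indicators of {t <= phi}. *)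
Lemma multiplier_layer_cake phi :
  measurable_fun [set: T] phi -> (forall w, 0 <= phi w) ->
  setI_closed G -> (forall t, G [set w | t <= phi w]) -> multiplier G phi.
Proof.
move=> mphi phi0 GI Gphi.
pose f (p : T * R) : R := \1_[set p : T * R | 0 <= p.2 <= phi p.1] p.
have mD : measurable [set p : T * R | 0 <= p.2 <= phi p.1].
  rewrite (_ : [set _ | _] = [set p : T * R | 0 <= p.2] `&` [set p | p.2 <= phi p.1]).
    apply: measurableI; rewrite -[X in measurable X]setTI.
      exact: measurable_fun_le.
    apply: measurable_fun_le => //.
    exact: (measurableT_comp mphi measurable_fst).
  by apply/seteqP; split => p /=; [move=> /andP|move=> [-> ->]].
apply: (@multiplier_integral _ _ (@lebesgue_measure R) f).
- exact: measurable_indic.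
- by move=> p; rewrite /f.
- move=> w; rewrite (_ : (fun y => _) = (fun y => (\1_`[0, phi w]%classic y)%:E)).
    rewrite integral_indic//= setIT lebesgue_measure_itv/= lte_fin.
    by case: ltgtP (phi0 w) => // [_ _|<- _]; rewrite ?sube0.
  apply/funext => y; congr EFin; rewrite /f !indicE; apply: (congr1 (fun b : bool => b%:R)).
- move=> y; have [y0|y0] := leP 0 y; last first.
    rewrite (_ : (fun w => _) = cst 0); first exact: multiplier_cst.
    apply/funext => w; rewrite /f indicE memNset//=.
    by rewrite leNgt y0.
  rewrite (_ : (fun w => _) = \1_[set w | y <= phi w]).
    by apply: multiplier_indic => [B GB|]; [exact: GI|exact: mG].
  apply/funext => w; rewrite /f !indicE; apply: (congr1 (fun b : bool => b%:R)).
  by apply/idP/idP; rewrite !inE/= y0.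
Qed.

Lemma multiplier_sub_measurable phi : setI_closed G ->
  sub_measurable G phi -> (forall w, 0 <= phi w) -> multiplier G phi.
Proof.
move=> GI Gphi phi0; apply: multiplier_layer_cake => //.
- by move=> _ A mA; rewrite setTI; exact/mG/Gphi.
- move=> t; rewrite (_ : [set _ | _] = phi @^-1` `[t, +oo[%classic).
    by apply: Gphi; exact: measurable_itv.
  by apply/seteqP; split => w /=; rewrite in_itv/= andbT.
Qed.

End multipliers.

(** A test set [A] of the larger family is absorbed into [U] and [V]: these then agree on every [B]
    in [G], because [B] cut with [A] is again in [G'], and the multiplier property over [G] is
    tested on the whole space only. *)
Lemma multiplier_sub {d1 : measure_display} {T : measurableType d1} {R : realType}
    (P : {sigma_finite_measure set T -> \bar R}) (G G' : set (set T)) (phi : T -> R) :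
  G' `<=` measurable -> setI_closed G' -> G [set: T] -> G `<=` G' ->
  multiplier P G phi -> multiplier P G' phi.
Proof.
move=> mG' GI' GT GG' [mphi phi0 Hphi]; split => // U V mU mV U0 V0 UV A GA.
have mA : measurable_fun [set: T] (\1_A : T -> R).
  exact: measurable_indic (mG' _ GA).
have mAM (W : T -> R) : measurable_fun [set: T] W ->
    measurable_fun [set: T] (fun w => \1_A w * W w).
  by move=> mW; exact: measurable_funM.
have A0 (W : T -> R) : (forall w, 0 <= W w) -> forall w, 0 <= \1_A w * W w.
  by move=> W0 w; rewrite mulr_ge0.
suff UVA : same_integrals P G (fun w => \1_A w * U w) (fun w => \1_A w * V w).
  have := Hphi _ _ (mAM _ mU) (mAM _ mV) (A0 _ U0) (A0 _ V0) UVA _ GT.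
  have E (W : T -> R) w : \1_[set: T] w * (phi w * (\1_A w * W w)) =
      \1_A w * (phi w * W w) by rewrite indicT mul1r mulrCA.
  under eq_integral do rewrite E.
  by under [X in _ = X -> _]eq_integral do rewrite E.
move=> B GB; have E (W : T -> R) w : \1_B w * (\1_A w * W w) = \1_(B `&` A) w * W w.
  by rewrite indicI/= mulrA.
under eq_integral do rewrite E.
under [RHS]eq_integral do rewrite E.
by apply: UV; apply: GI' => //; exact: GG'.
Qed.

Lemma integral_indicM {d1 : measure_display} {T : measurableType d1} {R : realType}
    (P : {measure set T -> \bar R}) (E : set T) (f : T -> R) : measurable E ->
  (\int[P]_(w in E) (f w)%:E = \int[P]_w (\1_E w * f w)%:E)%E.
Proof.
move=> mE; rewrite integral_mkcond; apply: eq_integral => w _.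
by rewrite /patch indicE; case: ifP => _; rewrite ?mul1r ?mul0r.
Qed.

(** * Conditional independence: adding events of other cubes does not change conditional means *)

Section conditional_independence.
Context {d1 : measure_display} {T : measurableType d1} {R : realType}.
Context (P : probability T R) {I : eqType}.

(** The pi-system of rectangles generating the sigma-algebra spanned by [B] and the [F i],
    [i \in s]. Multipliers work with families closed under intersection, so it stands in for that
    sigma-algebra. *)
Definition joint_events (B : set (set T)) (F : I -> set (set T)) (s : seq I) :
    set (set T) :=
  [set H | exists E (A : I -> set T),
    [/\ B E, (forall i, i \in s -> F i (A i)) &
        H = E `&` \bigcap_(i in [set j | j \in s]) A i]].

Lemma bigcap_in_seq (s : seq I) (A : I -> set T) :
  \bigcap_(i in [set j | j \in s]) A i = \big[setI/setT]_(i <- s) A i.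
Proof.
elim: s => [|i s IH]; first by rewrite big_nil; apply/seteqP; split.
rewrite big_cons -IH; apply/seteqP; split=> w.
  move=> H; split => [|j js]; first exact/H/mem_head.
  by apply: H; rewrite /= inE js orbT.
by move=> [Aw H] j /=; rewrite inE => /predU1P[->//|]; exact: H.
Qed.

Lemma measurable_bigcap_in (s : seq I) (A : I -> set T) :
  (forall i, i \in s -> measurable (A i)) ->
  measurable (\bigcap_(i in [set j | j \in s]) A i).
Proof.
by move=> mA; rewrite bigcap_in_seq big_seq; exact: bigsetI_measurable.
Qed.

(** Factors are exchanged one at a time, all the others forming a multiplier. The purpose is to pass
    between different versions of the same conditional probabilities inside a product. *)
Lemma same_integrals_prod (G : set (set T)) (s : seq I) (Y Y' : I -> T -> R) :
  G `<=` measurable ->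
  (forall i, i \in s -> multiplier P G (Y i)) ->
  (forall i, i \in s -> multiplier P G (Y' i)) ->
  (forall i, i \in s -> same_integrals P G (Y i) (Y' i)) ->
  forall phi, multiplier P G phi ->
  same_integrals P G (fun w => phi w * \prod_(i <- s) Y i w)
                     (fun w => phi w * \prod_(i <- s) Y' i w).
Proof.
move=> mG; elim: s => [|i s IH] HY HY' YY' phi Hphi A GA.
  by under eq_integral do rewrite big_nil; under [RHS]eq_integral do rewrite big_nil.
have Yi := HY i (mem_head _ _); have Y'i := HY' i (mem_head _ _).
have is_ j : j \in s -> j \in i :: s by rewrite inE orbC => ->.
under eq_integral do rewrite big_cons mulrA.
rewrite (IH _ _ _ (fun w => phi w * Y i w))//; first last.
- exact: multiplierM.
- by move=> j /is_; exact: YY'.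
- by move=> j /is_; exact: HY'.
- by move=> j /is_; exact: HY.
have [mY Y0 _] := Yi; have [mY' Y'0 _] := Y'i.
have Hprod : multiplier P G (fun w => phi w * \prod_(j <- s) Y' j w).
  by apply: multiplierM => //; apply: multiplier_prod => // j /is_; exact: HY'.
have [_ _ /(_ (Y i) (Y' i) mY mY' Y0 Y'0 (YY' i (mem_head _ _)) A GA)] := Hprod.
under eq_integral do rewrite mulrAC.
by move=> ->; apply: eq_integral => w _; rewrite big_cons mulrAC mulrA.
Qed.

Context (B : set (set T)) (F : I -> set (set T)) (K : set I).
Context (sB : sigma_algebra [set: T] B).
Context (mB : B `<=` measurable).
Context (sF : forall i, sigma_algebra [set: T] (F i)).
Context (mF : forall i, F i `<=` measurable).

Lemma sigma_algebra_setT (G : set (set T)) : sigma_algebra [set: T] G -> G [set: T].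
Proof. by case=> G0 GD _; rewrite -(setD0 [set: T]); exact: GD. Qed.

Lemma sigma_algebra_setI (G : set (set T)) : sigma_algebra [set: T] G -> setI_closed G.
Proof.
by move=> /(sigma_algebraP (fun X _ => @subsetT _ X))[].
Qed.

Lemma measurable_joint (s : seq I) : joint_events B F s `<=` measurable.
Proof.
move=> _ [E [A [BE FA ->]]]; apply: measurableI; first exact: mB.
by apply: measurable_bigcap_in => i /FA; exact: mF.
Qed.

Lemma joint_setI (s : seq I) : setI_closed (joint_events B F s).
Proof.
move=> _ _ [E [A [BE FA ->]]] [E' [A' [BE' FA' ->]]].
exists (E `&` E'), (fun i => A i `&` A' i); split.
- exact: (sigma_algebra_setI sB).
- by move=> i si; apply: (sigma_algebra_setI (sF i)); [exact: FA|exact: FA'].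
- by rewrite bigcapI setIACA.
Qed.

Lemma sub_joint_events s : B `<=` joint_events B F s.
Proof.
move=> E BE; exists E, (fun=> setT); split => //.
- by move=> i _; exact: sigma_algebra_setT.
- by apply/seteqP; split=> [w Ew|w []].
Qed.

Lemma sub_joint_events_i s i : i \in s -> F i `<=` joint_events B F s.
Proof.
move=> si A FA; exists setT, (fun j => if j == i then A else setT); split.
- exact: sigma_algebra_setT.
- by move=> j _; case: eqP => [->//|_]; exact: sigma_algebra_setT.
- rewrite setTI; apply/seteqP; split => w.
    by move=> Aw j _ /=; case: ifP.
  by move/(_ i si) => /=; rewrite eqxx.
Qed.

Context (cond : cond_indep P B F K).

Lemma cond_prob_version_multiplier A Y : cond_prob_version P B A Y ->
  multiplier P B Y.
Proof.
move=> [BY [Y0 _]]; apply: multiplier_sub_measurable => //.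
exact: sigma_algebra_setI.
Qed.

Lemma cond_prob_version_integral A Y : measurable A -> cond_prob_version P B A Y ->
  same_integrals P B Y \1_A.
Proof.
move=> mA [_ [_ HY]] E BE; rewrite -!integral_indicM; [|exact: mB..].
rewrite (HY _ BE) setIC.
have mE := mB BE.
by rewrite (integral_indic P mE mA).
Qed.

(** The conditional mean [g] of [f] given [B] is still its conditional mean once the events of the
    [F j], [j \in s], are known too: on a rectangle, the indicator of the [F j] part can be traded
    for its conditional probability given [B] and back. *)
Lemma cond_indep_same_integrals (s : seq I) i (f g : T -> R) :
  uniq (i :: s) -> (forall j, j \in i :: s -> K j) ->
  sub_measurable (F i) f -> (forall w, 0 <= f w) ->
  sub_measurable B g -> (forall w, 0 <= g w) ->
  same_integrals P B f g ->
  same_integrals P (joint_events B F s) f g.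
Proof.
move=> /= /andP[iNs us] Ks Ff f0 Bg g0 fg _ [E [A [BE FA ->]]].
set W := \bigcap_(_ in _) A _.
have mW : measurable W.
  by apply: measurable_bigcap_in => j /FA; exact: mF.
have mE : measurable E by exact: mB.
have mAj j : j \in s -> measurable (A j) by move=> /FA; exact: mF.
have is_ j : j \in s -> j \in i :: s by rewrite inE orbC => ->.
have [Y [YA YW]] := cond us (fun j js => Ks j (is_ j js)) FA.
(* A version of the conditional probability of [W] given [B]. *)
pose Z w := \prod_(j <- s) Y j w.
have HZ : multiplier P B Z.
  apply: multiplier_prod => // j js.
  exact: cond_prob_version_multiplier (YA j js).
have [mZ Z0 _] := HZ.
have Hf : multiplier P (F i) f.
  by apply: multiplier_sub_measurable => //; exact: sigma_algebra_setI.
have Hg : multiplier P B g.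
  by apply: multiplier_sub_measurable => //; exact: sigma_algebra_setI.
have [mf _ _] := Hf; have [mg _ _] := Hg.
have WZ : same_integrals P B \1_W Z.
  move=> E' BE'; rewrite -!integral_indicM; [|exact: mB..].
  by rewrite (integral_indic P (mB BE') mW) -(YW _ BE') setIC.
(* For [D] in [F i], conditional independence for [i :: s] writes the probability of [E], [D] and
   [W] together as the integral over [E] of P(D | B) [Z]; since [Z] is a [B]-multiplier, P(D | B)
   may be replaced there by the indicator of [D]. *)
have WZF : same_integrals P (F i) (fun w => \1_E w * \1_W w) (fun w => \1_E w * Z w).
  move=> D FD; have mD := mF FD.
  pose A' j := if j == i then D else A j.
  have A's j : j \in s -> A' j = A j.
    by rewrite /A'; case: eqP => // -> si; rewrite si in iNs.
  have A'i : A' i = D by rewrite /A' eqxx.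
  have FA' j : j \in i :: s -> F j (A' j).
    by rewrite inE => /orP[/eqP ->|js]; rewrite ?A'i// A's//; exact: FA.
  have uis : uniq (i :: s) by rewrite /= iNs.
  have [Y' [Y'A Y'W]] := cond uis Ks FA'.
  have PE : (P (E `&` (D `&` W)) = \int[P]_w (\1_E w * (Z w * \1_D w))%:E)%E.
    have -> : D `&` W = \bigcap_(j in [set j | j \in i :: s]) A' j.
      rewrite bigcap_in_seq big_cons A'i; congr (_ `&` _); rewrite /W bigcap_in_seq.
      by rewrite big_seq [RHS]big_seq; apply: eq_bigr => j /A's.
    have Yi := Y'A i (mem_head _ _); rewrite A'i in Yi.
    have HYi := cond_prob_version_multiplier Yi; have [mYi Yi0 _] := HYi.
    rewrite (Y'W _ BE) (integral_indicM P _ mE).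
    under eq_integral do rewrite big_cons.
    (* The versions [Y' j] obtained for [i :: s] may differ from the [Y j] obtained for [s]; both
       have the same integrals over [B] as the indicator of [A j], so they can be exchanged. *)
    transitivity (\int[P]_w (\1_E w * (Y' i w * Z w))%:E)%E.
      apply: (@same_integrals_prod B s Y' Y mB _ _ _ (Y' i) HYi E BE) => j js.
      - exact: cond_prob_version_multiplier (Y'A j (is_ j js)).
      - exact: cond_prob_version_multiplier (YA j js).
      - move=> E' BE'; have Yj := Y'A j (is_ j js); rewrite A's// in Yj.
        rewrite (cond_prob_version_integral (mAj _ js) Yj BE').
        by rewrite (cond_prob_version_integral (mAj _ js) (YA j js) BE').
    under eq_integral do rewrite (mulrC (Y' i _)).
    have [_ _ HZ'] := HZ; apply: (HZ' (Y' i) (\1_D)) => //.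
    exact: (cond_prob_version_integral mD Yi).
  transitivity (P (E `&` (D `&` W))).
    rewrite -[in RHS](setIT (E `&` _)).
    rewrite -(integral_indic P measurableT (measurableI _ _ mE (measurableI _ _ mD mW))).
    by apply: eq_integral => w _; rewrite !indicI/= mulrCA.
  by rewrite PE; apply: eq_integral => w _; rewrite mulrCA (mulrC (\1_D w)) mulrCA mulrA.
have mEW : measurable_fun [set: T] (fun w => \1_E w * \1_W w : R).
  exact: measurable_funM.
have mEZ : measurable_fun [set: T] (fun w => \1_E w * Z w : R).
  exact: measurable_funM.
have EW0 w : 0 <= \1_E w * \1_W w :> R by rewrite mulr_ge0.
have EZ0 w : 0 <= \1_E w * Z w :> R by rewrite mulr_ge0.
(* Three exchanges: with the multiplier [f] the indicator of [W] becomes [Z], with the multiplier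
   [Z] the function [f] becomes [g], and with the multiplier [g] the [Z] turns back into the
   indicator. *)
transitivity (\int[P]_w (\1_E w * (Z w * f w))%:E)%E.
  have [_ _ /(_ _ _ mEW mEZ EW0 EZ0 WZF setT (sigma_algebra_setT (sF i)))] := Hf.
  under eq_integral do rewrite indicT mul1r.
  under [X in _ = X -> _]eq_integral do rewrite indicT mul1r.
  move=> H; transitivity (\int[P]_w (f w * (\1_E w * \1_W w))%:E)%E.
    by apply: eq_integral => w _; rewrite indicI/= mulrC.
  by rewrite H; apply: eq_integral => w _; rewrite mulrCA (mulrC (f w)).
have [_ _ /(_ _ _ mf mg f0 g0 fg E BE) ->] := HZ.
have [_ _ /(_ (Z) (\1_W) mZ _ Z0 _ _ E BE)] := Hg.
under eq_integral do rewrite mulrC.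
move=> H; transitivity (\int[P]_w (\1_E w * (g w * \1_W w))%:E)%E.
  rewrite -H//; first by apply: eq_integral => w _; rewrite mulrC (mulrC (g w)).
  by move=> E' /WZ.
by apply: eq_integral => w _; rewrite indicI/= mulrCA mulrC.
Qed.

End conditional_independence.

(** * Exponential moments and the tail bound for cubes of one colour *)

Lemma expR_chord {R : realType} (rho x : R) : 0 <= x <= 1 ->
  expR (rho * x) <= 1 + (expR rho - 1) * x.
Proof.
move=> /andP[x0 x1]; have := convex_expR (Itv01 x0 x1) rho 0.
rewrite !convRE/= /unstable.onem mulr0 addr0 expR0 mulr1 mulrC => /le_trans; apply.
by rewrite mulrBl mul1r addrCA mulrC.
Qed.

Section exponential_moment.
Context {d1 d2 : measure_display} {T : measurableType d1} {T2 : measurableType d2}.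
Context {R : realType} (P : probability T R) {I : eqType}.
Context (nu : {finite_measure set T2 -> \bar R}).
Context (B : set (set T)) (F : I -> set (set T)) (K : set I).
Context (sB : sigma_algebra [set: T] B).
Context (mB : B `<=` measurable).
Context (sF : forall i, sigma_algebra [set: T] (F i)).
Context (mF : forall i, F i `<=` measurable).
Context (cond : cond_indep P B F K).
Context (Q : I -> set T2) (mQ : forall i, measurable (Q i)).
Context (f g : T * T2 -> R).
Context (mf : measurable_fun [set: T * T2] f) (mg : measurable_fun [set: T * T2] g).
Context (f0 : forall p, 0 <= f p) (g0 : forall p, 0 <= g p).
Context (Ff : forall i y, Q i y -> sub_measurable (F i) (fun w => f (w, y))).
Context (Bg : forall y, sub_measurable B (fun w => g (w, y))).
Context (fg : forall y, same_integrals P B (fun w => f (w, y)) (fun w => g (w, y))).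
Context (X m : I -> T -> R).
Context (Xf : forall i w, (\int[nu]_(y in Q i) (f (w, y))%:E = (X i w)%:E)%E).
Context (mg_ : forall i w, (\int[nu]_(y in Q i) (g (w, y))%:E = (m i w)%:E)%E).

(** The cut-off makes the mass of a cube an integral over the whole space, as [multiplier_integral]
    wants, and is zero at those [y] where [Ff] gives no measurability. *)
Let restr (h : T * T2 -> R) i (p : T * T2) := \1_(Q i) p.2 * h p.

Let measurable_restr h i : measurable_fun [set: T * T2] h ->
  measurable_fun [set: T * T2] (restr h i).
Proof.
move=> mh; apply: measurable_funM => //.
have m1 : measurable_fun [set: T2] (\1_(Q i) : T2 -> R) by exact: measurable_indic.
exact: (measurableT_comp m1 measurable_snd).
Qed.

Let restr0 h i : (forall p, 0 <= h p) -> forall p, 0 <= restr h i p.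
Proof. by move=> h0 p; rewrite mulr_ge0. Qed.

Let integral_restr (h : T * T2 -> R) (Z : I -> T -> R) :
  (forall i w, (\int[nu]_(y in Q i) (h (w, y))%:E = (Z i w)%:E)%E) ->
  forall i w, (\int[nu]_y (restr h i (w, y))%:E = (Z i w)%:E)%E.
Proof. by move=> Zh i w; rewrite -Zh (integral_indicM nu _ (mQ i)). Qed.

Let multiplier_restr (G : set (set T)) h i y : G `<=` measurable ->
  (Q i y -> multiplier P G (fun w => h (w, y))) ->
  multiplier P G (fun w => restr h i (w, y)).
Proof.
move=> mG Hh; rewrite /restr/=; have [Qy|Qy] := pselect (Q i y).
  by under eq_fun do rewrite indicE mem_set// mul1r; exact: Hh.
by under eq_fun do rewrite indicE memNset// mul0r; exact: multiplier_cst.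
Qed.

Let multiplier_g y : multiplier P B (fun w => g (w, y)).
Proof.
by apply: multiplier_sub_measurable => //; exact: sigma_algebra_setI.
Qed.

Lemma multiplier_mass i : multiplier P B (m i).
Proof.
apply: (multiplier_integral mB (measurable_restr i mg) (restr0 i g0) (integral_restr mg_ i)).
by move=> y; apply: multiplier_restr => // _; exact: multiplier_g.
Qed.

Lemma multiplier_next_mass s i : i \in s -> multiplier P (joint_events B F s) (X i).
Proof.
move=> si; have mJ := @measurable_joint _ _ _ B F mB mF s.
apply: (multiplier_integral mJ (measurable_restr i mf) (restr0 i f0) (integral_restr Xf i)).
move=> y; apply: multiplier_restr => // Qy.
apply: (@multiplier_sub _ _ _ _ (F i)) => //.
- exact: joint_setI.
- exact: sigma_algebra_setT.
- exact: sub_joint_events_i.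
- apply: multiplier_sub_measurable => //; last exact: Ff.
  exact: sigma_algebra_setI.
Qed.

Let mX i : measurable_fun [set: T] (X i).
Proof.
exact: (measurable_integral_param (measurable_restr i mf) (restr0 i f0) (integral_restr Xf i)).
Qed.

Let X0 i w : 0 <= X i w.
Proof. by rewrite -lee_fin -Xf integral_ge0// => y _; rewrite lee_fin. Qed.

Let mm i : measurable_fun [set: T] (m i).
Proof. by have [] := multiplier_mass i. Qed.

Let m0 i w : 0 <= m i w.
Proof. by have [_ + _] := multiplier_mass i; exact. Qed.

(** The [X i] are replaced by the [m i] one at a time, each against the product of the remaining
    factors. The free multiplier [psi] is there for the induction: it collects the factors
    [1 + c * m i] already converted. *)
Lemma integral_prod_mass (c : R) (s : seq I) (psi : T -> R) : 0 <= c ->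
  uniq s -> (forall i, i \in s -> K i) -> multiplier P B psi ->
  (\int[P]_w (\prod_(i <- s) (1 + c * X i w) * psi w)%:E =
   \int[P]_w (\prod_(i <- s) (1 + c * m i w) * psi w)%:E)%E.
Proof.
move=> c0; elim: s psi => [|i s IH] psi us Ks Hpsi.
  by apply: eq_integral => w _; rewrite !big_nil.
have /= /andP[iNs us'] := us.
have Ks' j : j \in s -> K j by move=> js; apply: Ks; rewrite inE js orbT.
have HcX G (Z : T -> R) : G `<=` measurable -> multiplier P G Z ->
    multiplier P G (fun w => 1 + c * Z w).
  move=> mG HZ; apply: multiplierD => //; first exact: multiplier_cst.
  by apply: multiplierM => //; exact: multiplier_cst.
have mJ := @measurable_joint _ _ _ B F mB mF s.
pose Phi w := \prod_(j <- s) (1 + c * X j w) * psi w.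
have HPhi : multiplier P (joint_events B F s) Phi.
  apply: multiplierM.
    apply: multiplier_prod => // j js; apply: HcX => //.
    exact: multiplier_next_mass.
  apply: multiplier_sub Hpsi => //.
  - exact: joint_setI.
  - exact: sigma_algebra_setT.
  - exact: sub_joint_events.
have [mPhi Phi0 HPhi'] := HPhi.
(* By Tonelli the comparison is made at fixed [y]: off [Q i] both sides vanish, and on [Q i] the
   functions [f] and [g] have the same integrals over the joint events, for which [Phi] is a
   multiplier. *)
have PhiX : (\int[P]_w (Phi w * X i w)%:E = \int[P]_w (Phi w * m i w)%:E)%E.
  rewrite (integral_param_mul P (measurable_restr i mf) (restr0 i f0) (integral_restr Xf i) mPhi Phi0).
  rewrite (integral_param_mul P (measurable_restr i mg) (restr0 i g0) (integral_restr mg_ i) mPhi Phi0).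
  apply: eq_integral => y _.
  rewrite /restr/=; have [Qy|Qy] := pselect (Q i y); last first.
    by apply: eq_integral => w _; rewrite indicE memNset// !mul0r.
  have mfy : measurable_fun [set: T] (fun w => f (w, y)) by exact: measurable_fun_pair1.
  have mgy : measurable_fun [set: T] (fun w => g (w, y)) by exact: measurable_fun_pair1.
  have fgy := cond_indep_same_integrals sB mB sF mF cond us Ks (Ff Qy)
    (fun w => f0 (w, y)) (Bg y) (fun w => g0 (w, y)) (fg y).
  have JT : joint_events B F s [set: T].
    by apply: sub_joint_events => //; exact: sigma_algebra_setT.
  have := HPhi' _ _ mfy mgy (fun w => f0 (w, y)) (fun w => g0 (w, y)) fgy _ JT.
  have E (h : T * T2 -> R) w :
    \1_[set: T] w * (Phi w * h (w, y)) = Phi w * (\1_(Q i) y * h (w, y)).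
    by rewrite indicT mul1r indicE mem_set// mul1r.
  under eq_integral do rewrite E.
  by under [X in _ = X -> _]eq_integral do rewrite E.
have Ephi (Z : T -> R) : measurable_fun [set: T] Z -> (forall w, 0 <= Z w) ->
    (\int[P]_w (Phi w * (1 + c * Z w))%:E =
     \int[P]_w (Phi w)%:E + c%:E * \int[P]_w (Phi w * Z w)%:E)%E.
  move=> mZ Z0; under eq_integral do rewrite mulrDr mulr1 mulrCA EFinD (EFinM c).
  have mPZ : measurable_fun [set: T] (fun w => (Phi w * Z w)%:E).
    by apply/measurable_EFinP; exact: measurable_funM.
  have PZ0 w : (0 <= (Phi w * Z w)%:E)%E by rewrite lee_fin mulr_ge0.
  rewrite ge0_integralD//.
  - by rewrite ge0_integralZl_EFin.
  - by move=> w _; rewrite lee_fin.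
  - exact/measurable_EFinP.
  - by move=> w _; rewrite mule_ge0.
  - exact: measurable_funeM.
transitivity (\int[P]_w (Phi w * (1 + c * X i w))%:E)%E.
  by apply: eq_integral => w _; rewrite big_cons /Phi; congr EFin; rewrite [RHS]mulrC mulrA.
rewrite Ephi// PhiX -Ephi//.
transitivity (\int[P]_w (\prod_(j <- s) (1 + c * X j w) * ((1 + c * m i w) * psi w))%:E)%E.
  by apply: eq_integral => w _; rewrite /Phi -mulrA (mulrC (psi w)).
rewrite (IH (fun w => (1 + c * m i w) * psi w))//; last first.
  by apply: multiplierM => //; exact: HcX (multiplier_mass i).
by apply: eq_integral => w _; rewrite big_cons mulrCA mulrA.
Qed.

Context (M : R) (M0 : 0 <= M) (gM : forall p, g p <= M).

(* [expR (- c m)] is not a series of nonnegative multipliers, but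
   [expR (c (D - m))] is one when [D] bounds [m]; the constant [D] cancels. *)
Lemma exponential_moment (c : R) (s : seq I) : 0 <= c ->
  uniq s -> (forall i, i \in s -> K i) ->
  (\int[P]_w (\prod_(i <- s) ((1 + c * X i w) * expR (- (c * m i w))))%:E <= 1)%E.
Proof.
move=> c0 us Ks.
pose D i := M * fine (nu (Q i)).
have ED i w : (\int[nu]_(y in Q i) (M - g (w, y))%:E = (D i - m i w)%:E)%E.
  have mgw : measurable_fun (Q i) (fun y => g (w, y)).
    by apply: measurable_funTS; exact: measurable_fun_pair2.
  have H : (\int[nu]_(y in Q i) (M - g (w, y))%:E + (m i w)%:E = (D i)%:E)%E.
    rewrite -mg_ -ge0_integralD//.
    - transitivity (\int[nu]_(y in Q i) (M%:E * (cst 1%E y)))%E.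
        by apply: eq_integral => y _; rewrite -EFinD subrK mule1.
      rewrite ge0_integralZl_EFin// integral_cst// mul1e /D EFinM fineK//.
      exact: fin_num_measure.
    - by move=> y _; rewrite lee_fin subr_ge0.
    - by apply/measurable_EFinP; exact: measurable_funB.
    - by move=> y _; rewrite lee_fin.
    - exact/measurable_EFinP.
  by rewrite EFinB -H addeK.
have HD i : multiplier P B (fun w => D i - m i w).
  have mMg : measurable_fun [set: T * T2] (fun p => M - g p) by exact: measurable_funB.
  have Mg0 p : 0 <= M - g p by rewrite subr_ge0.
  apply: (multiplier_integral mB (measurable_restr i mMg) (restr0 i Mg0) (integral_restr ED i)).
  move=> y; apply: multiplier_restr => // _.
  apply: multiplier_sub_measurable => //; first exact: sigma_algebra_setI.
  move=> A mA.
  rewrite (_ : _ @^-1` _ = (fun w => g (w, y)) @^-1` ((fun x => M - x) @^-1` A)) //.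
  apply: Bg; rewrite -[X in measurable X]setTI.
  by apply: measurable_funB.
pose psi w := \prod_(i <- s) expR (c * (D i - m i w)).
have Hpsi : multiplier P B psi.
  apply: multiplier_prod => // i _.
  by apply: multiplier_expR => //; apply: multiplierM => //; exact: multiplier_cst.
have [mpsi psi0 _] := Hpsi.
have Hprod (Z : I -> T -> R) : (forall i, measurable_fun [set: T] (Z i)) ->
    measurable_fun [set: T] (fun w => (\prod_(i <- s) (1 + c * Z i w) * psi w)%:E).
  move=> mZ; apply/measurable_EFinP; apply: measurable_funM => //.
  apply: measurable_prod => i _; apply: measurable_funD => //.
  exact: measurable_funM.
have Hprod0 (Z : I -> T -> R) : (forall i w, 0 <= Z i w) ->
    forall w, 0 <= \prod_(i <- s) (1 + c * Z i w) * psi w.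
  move=> Z0 w; rewrite mulr_ge0// prodr_ge0// => i _.
  by rewrite addr_ge0// mulr_ge0.
have bound : (\int[P]_w (\prod_(i <- s) (1 + c * X i w) * psi w)%:E <=
              (expR (\sum_(i <- s) c * D i))%:E)%E.
  rewrite integral_prod_mass//.
  have -> : (expR (\sum_(i <- s) c * D i))%:E =
      (\int[P]_w (cst (expR (\sum_(i <- s) c * D i))%:E w))%E.
    by rewrite integral_cst//= probability_setT mule1.
  apply: ge0_le_integral => //.
  - by move=> w _; rewrite lee_fin Hprod0.
  - exact: Hprod.
  (* Factor by factor, [1 + c * m <= expR (c * m)] and the product of [expR (c * m)] with
     [expR (c * (D - m))] is the constant [expR (c * D)]. *)
  move=> w _; rewrite lee_fin expR_sum /psi -big_split/=.
  apply: ler_prod => i _; apply/andP; split.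
    by rewrite mulr_ge0 ?expR_ge0// addr_ge0// mulr_ge0.
  have -> : expR (c * D i) = expR (c * m i w) * expR (c * (D i - m i w)).
    by rewrite -expRD -mulrDr addrC subrK.
  by rewrite ler_wpM2r ?expR_ge0// expR_ge1Dx.
have -> : (\int[P]_w (\prod_(i <- s) ((1 + c * X i w) * expR (- (c * m i w))))%:E =
   (expR (- \sum_(i <- s) c * D i))%:E *
   \int[P]_w (\prod_(i <- s) (1 + c * X i w) * psi w)%:E)%E.
  rewrite -ge0_integralZl_EFin ?expR_ge0//.
  - apply: eq_integral => w _; rewrite -EFinM; congr EFin.
    rewrite -sumrN expR_sum mulrCA /psi -!big_split/=.
    apply: eq_bigr => i _; rewrite -expRD; congr (_ * expR _).
    by rewrite mulrBr addrA addNr add0r.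
  - by move=> w _; rewrite lee_fin Hprod0.
  - exact: Hprod.
apply: le_trans (_ : ((expR (- \sum_(i <- s) c * D i))%:E *
  (expR (\sum_(i <- s) c * D i))%:E <= 1)%E); last first.
  by rewrite -EFinM -expRD addNr expR0.
by apply: lee_wpmul2l => //; rewrite lee_fin expR_ge0.
Qed.

Lemma mass_tail (rho b q u : R) (s : seq I) : 0 <= rho -> 0 < b ->
  expR rho - 1 <= q * rho -> uniq s -> (forall i, i \in s -> K i) ->
  {ae P, forall w, forall i, i \in s -> X i w <= b} ->
  (P [set w | (q * (\sum_(i <- s) m i w) + u <= \sum_(i <- s) X i w)%R] <=
   (expR (- (rho * u / b)))%:E)%E.
Proof.
move=> rho0 b0 rhoq us Ks Xb.
set A := [set w | _].
pose c := (expR rho - 1) / b.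
have c0 : 0 <= c by rewrite divr_ge0 ?(ltW b0)// subr_ge0 -expR0 ler_expR.
pose Psi w := \prod_(i <- s) ((1 + c * X i w) * expR (- (c * m i w))).
have mA : measurable A.
  rewrite -[A]setTI; apply: measurable_fun_le => //.
    apply: measurable_funD => //; apply: measurable_funM => //.
    exact: measurable_sum.
  exact: measurable_sum.
have mPsi : measurable_fun [set: T] Psi.
  apply: measurable_prod => i _; apply: measurable_funM.
    by apply: measurable_funD => //; exact: measurable_funM.
  by apply: measurableT_comp => //; apply: measurableT_comp => //; exact: measurable_funM.
have mPsiE : measurable_fun [set: T] (fun w => (Psi w)%:E) by exact/measurable_EFinP.
have Psi0 w : 0 <= Psi w.
  by apply: prodr_ge0 => i _; rewrite mulr_ge0 ?expR_ge0// addr_ge0// mulr_ge0.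
have -> : P A = (\int[P]_w (\1_A w)%:E)%E by rewrite integral_indic// setIT.
(* Markov's inequality as a comparison of integrands; it holds only almost surely because [X i <= b]
   does. *)
apply: (@le_trans _ _ (\int[P]_w ((expR (- (rho * u / b)))%:E * (Psi w)%:E))%E).
  apply: ae_ge0_le_integral => //.
  - by apply/measurable_EFinP; exact: measurable_indic.
  - by move=> w _; rewrite mule_ge0// lee_fin ?expR_ge0.
  - exact: measurable_funeM.
  move: Xb; apply: filterS => w Xb _.
  rewrite -EFinM lee_fin indicE; have [Aw|Aw] := pselect (A w); last first.
    by rewrite memNset// mulr_ge0 ?expR_ge0.
  (* On [A] the exponents add up to a nonnegative number, so this expression is at least 1. Each
     factor is then compared by the chord bound for the first exponential and by [c <= q * rho / b]
     for the second. *)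
  rewrite mem_set//=; apply: (@le_trans _ _ (expR (- (rho * u / b)) *
      \prod_(i <- s) (expR (rho * (X i w / b)) * expR (- (q * rho / b * m i w))))).
    rewrite big_split/= -!expR_sum -expRD -expRD -expR0 ler_expR.
    rewrite sumrN -!mulr_sumr -mulr_suml.
    rewrite (_ : _ + _ = rho / b * (\sum_(i <- s) X i w - (q * (\sum_(i <- s) m i w) + u))).
      by rewrite mulr_ge0 ?divr_ge0 ?(ltW b0)// subr_ge0.
    by rewrite mulrBr mulrDr opprD addrCA; congr (_ + _); [ring|ring].
  rewrite ler_wpM2l ?expR_ge0// big_seq [leRHS]big_seq; apply: ler_prod => i si.
  rewrite mulr_ge0 ?expR_ge0//=; apply: ler_pM; rewrite ?expR_ge0//.
    have := @expR_chord _ rho (X i w / b).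
    rewrite /c mulrAC -mulrA; apply.
    by rewrite divr_ge0 ?(ltW b0)//= ler_pdivrMr// mul1r Xb.
  rewrite ler_expR lerN2 ler_wpM2r// /c ler_pM2r// invr_gt0//.
rewrite ge0_integralZl_EFin ?expR_ge0//.
- rewrite -[leRHS]mule1; apply: lee_wpmul2l; first by rewrite lee_fin expR_ge0.
  exact: exponential_moment.
- by move=> w _; rewrite lee_fin.
Qed.

End exponential_moment.

(** * Dyadic cubes: colouring, separation, covering and mass *)

Section dyadic_grid.
Context {R : realType} {d : nat}.
Implicit Types (x y : d.-tuple R) (k : 'I_d -> int).

Lemma measurable_dyadic_cube m k : measurable (@dyadic_cube R d m k).
Proof.
rewrite (_ : dyadic_cube m k = \bigcap_(i in [set: 'I_d])
  ((fun y => tnth y i) @^-1` `[(k i)%:~R / 2 ^+ m, ((k i)%:~R + 1) / 2 ^+ m[%classic)).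
  apply: fin_bigcap_measurable => [|i _]; first exact: finite_finset.
  rewrite -[X in measurable X]setTI.
  by apply: (@measurable_tnth _ R d i) => //; exact: measurable_itv.
apply/seteqP; split => y Hy i.
  by move=> _ /=; rewrite in_itv/=; apply/andP; exact: Hy.
by have := Hy i I; rewrite /= in_itv/= => /andP.
Qed.

Lemma dyadic_cube_floor m k y : dyadic_cube m k y ->
  forall i, k i = Num.floor (tnth y i * 2 ^+ m).
Proof.
move=> Hy i; have [lo hi] := Hy i; apply/esym/floor_def.
by rewrite intrD -ler_pdivrMr ?exprn_gt0// -ltr_pdivlMr ?exprn_gt0// lo hi.
Qed.

Lemma floor_dyadic_cube m y :
  dyadic_cube m (fun i => Num.floor (tnth y i * 2 ^+ m)) y.
Proof.
move=> i; have := floor_itv (tnth y i * 2 ^+ m).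
by rewrite intrD ler_pdivrMr ?exprn_gt0// ltr_pdivlMr ?exprn_gt0// => /andP.
Qed.

Lemma sqdist_ge x y i : (tnth x i - tnth y i) ^+ 2 <= sqdist x y.
Proof.
rewrite /sqdist (bigD1 i)//= lerDl sumr_ge0// => j _; exact: sqr_ge0.
Qed.

(** Seen from the lower corner every coordinate moves by at most 2^-m, so the squared distance is at
    most d 4^-m; the factor d+1 keeps the inequality strict, also for d = 0. *)
Lemma dyadic_cube_eball m k :
  dyadic_cube m k `<=`
  eball [tuple (k i)%:~R / 2 ^+ m | i < d] (d.+1%:R / 2 ^+ m : R).
Proof.
move=> y Hy; rewrite /eball/=.
have p0 : 0 < (2 ^+ m : R)^-1 by rewrite invr_gt0 exprn_gt0.
apply: (@le_lt_trans _ _ (\sum_(i < d) ((2 ^+ m : R)^-1) ^+ 2)).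
  apply: ler_sum => i _; have [lo hi] := Hy i; rewrite tnth_mktuple -sqrrN opprB.
  rewrite ler_pXn2r// ?nnegrE ?subr_ge0 ?(ltW p0)//.
  by rewrite lerBlDl; move: hi; rewrite mulrDl mul1r => /ltW.
rewrite sumr_const card_ord -[_ *+ d]mulr_natl exprMn ltr_pM2r ?exprn_gt0//.
by rewrite -natrX ltr_nat expnS expn1 (leq_trans (ltnSn d))// leq_pmulr.
Qed.

(* The cube indices are enumerated by pairs (a, r) of a block and a colour: two
   cubes of the same colour differ by a multiple of [M.+1] in some coordinate. *)
Definition grid_index (off M N : nat) (r : {ffun 'I_d -> 'I_M.+1})
    (a : {ffun 'I_d -> 'I_N.+1}) (i : 'I_d) : int :=
  (a i * M.+1 + r i)%N%:Z - off%:Z.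

Lemma grid_index_inj off M N r a r' a' :
  @grid_index off M N r a = @grid_index off M N r' a' -> r = r' /\ a = a'.
Proof.
move=> E; have Ei i : (a i * M.+1 + r i = a' i * M.+1 + r' i)%N.
  by have := congr1 (fun k => k i) E; rewrite /grid_index => /addIr[].
split; apply/ffunP => i; apply: val_inj.
  by have := congr1 (fun n => n %% M.+1)%N (Ei i); rewrite !modnMDl !modn_small.
by have := congr1 (fun n => n %/ M.+1)%N (Ei i); rewrite !divnMDl// !divn_small ?addn0.
Qed.

(** Distinct blocks of one colour have indices at least [M.+1] apart in some coordinate, so [M]
    whole cubes lie between them there: a gap of M 2^-(n+1), which is at least |c| 2^-n. *)
Lemma grid_index_separated off M N r (c : R) n : 2 * `|c| <= M%:R ->
  separated_cubes (c / 2 ^+ n) n.+1 [set k | exists a, k = @grid_index off M N r a].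
Proof.
move=> cM _ _ [a ->] [a' ->] aa' x y Hx Hy.
have [i ai] : exists i, a i <> a' i.
  apply: contrapT => H; apply: aa'; congr grid_index; apply/ffunP => i.
  by apply: contrapT => ai; apply: H; exists i.
have {}ai : a i <> a' i :> nat by move=> /val_inj.
apply: le_trans (sqdist_ge x y i).
have [lx hx] := Hx i; have [ly hy] := Hy i.
have p0 : 0 < (2 ^+ n.+1 : R) by rewrite exprn_gt0.
rewrite -(real_normK (num_real (c / _))) -(real_normK (num_real (_ - _))).
rewrite lerXn2r ?nnegrE//.
have {}cM : `|c / 2 ^+ n| <= M%:R / 2 ^+ n.+1.
  rewrite normrM normfV (@ger0_norm _ (2 ^+ n)) ?exprn_ge0//.
  rewrite exprS invfM mulrA ler_pM2r ?invr_gt0 ?exprn_gt0//.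
  by rewrite ler_pdivlMr// mulrC.
apply: le_trans cM _.
have gap (b b' : 'I_N.+1) (u v : R) : (b < b')%N ->
    u < ((((b * M.+1 + r i)%N%:Z - off%:Z)%:~R) + 1) / 2 ^+ n.+1 ->
    ((b' * M.+1 + r i)%N%:Z - off%:Z)%:~R / 2 ^+ n.+1 <= v ->
    M%:R / 2 ^+ n.+1 <= v - u.
  move=> bb'; rewrite ltr_pdivlMr// ler_pdivrMr// ler_pdivrMr// mulrBl.
  rewrite !rmorphB/= -!pmulrn => hu hv.
  have : (((b * M.+1 + r i) + M.+1)%N%:R <= (b' * M.+1 + r i)%N%:R :> R).
    by rewrite ler_nat addnAC leq_add2r addnC -mulSn leq_mul2r bb' orbT.
  rewrite natrD -(natr1 M); lra.
have [lt|gt|/val_inj//] := ltngtP (a i) (a' i).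
- by apply: le_trans (gap _ _ _ _ lt hx ly) _; rewrite distrC ler_norm.
- by apply: le_trans (gap _ _ _ _ gt hy lx) _; rewrite ler_norm.
Qed.

Lemma grid_index_cover m M (K : R) : exists off N : nat, forall y,
  (forall i, `|tnth y i| <= K) ->
  exists (r : {ffun 'I_d -> 'I_M.+1}) (a : {ffun 'I_d -> 'I_N.+1}),
    dyadic_cube m (grid_index off r a) y.
Proof.
(* Floors of the scaled coordinates lie in [-off, off), so the shift by [off] makes them nonnegative
   and below [2 * off]; their quotients by [M.+1] are no larger, whence this choice of [N]. *)
pose off := Num.bound `|K * 2 ^+ m|; exists off, (2 * off)%N => y yK.
have offP i : `|tnth y i * 2 ^+ m| < off%:R.
  rewrite normrM (@ger0_norm _ (2 ^+ m)) ?exprn_ge0//.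
  apply: (@le_lt_trans _ _ (K * 2 ^+ m)); first by rewrite ler_wpM2r ?exprn_ge0.
  by apply: le_lt_trans (ler_norm _) _; exact: archi_boundP.
pose z i := Num.floor (tnth y i * 2 ^+ m) + off%:Z.
have z0 i : 0 <= z i.
  rewrite -lerBlDr sub0r floor_ge_int rmorphN/= -pmulrn.
  by have := offP i; rewrite ltr_norml => /andP[/ltW].
have z_lt i : z i < (2 * off)%N%:Z.
  rewrite mul2n -addnn PoszD ltrD2r floor_lt_int -pmulrn.
  by have := offP i; rewrite ltr_norml => /andP[].
pose n i := `|z i|%N; have zn i : z i = n i by rewrite /n gez0_abs.
have n_lt i : (n i < (2 * off).+1 * M.+1)%N.
  by have := z_lt i; rewrite zn ltz_nat => /leq_trans; apply; exact: (leq_trans (leqnSn _) (leq_pmulr _ _)).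
(* Euclidean division of the shifted index: the remainder is the colour, the quotient the block. *)
pose r : {ffun 'I_d -> 'I_M.+1} := [ffun i => inord (n i %% M.+1)].
pose a : {ffun 'I_d -> 'I_(2 * off).+1} := [ffun i => inord (n i %/ M.+1)].
exists r, a; have -> : grid_index off r a = fun i => Num.floor (tnth y i * 2 ^+ m).
  apply/funext => i; rewrite /grid_index !ffunE !inordK ?ltn_mod//.
    by rewrite -divn_eq -zn /z addrK.
  by rewrite ltn_divLR.
exact: floor_dyadic_cube.
Qed.

Lemma integral_dyadic_grid (nu : {measure set (d.-tuple R) -> \bar R}) m off M N
    (h : d.-tuple R -> R) : measurable_fun setT h -> (forall y, 0 <= h y) ->
  (forall y, h y != 0 -> exists (r : {ffun 'I_d -> 'I_M.+1}) (a : {ffun 'I_d -> 'I_N.+1}),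
    dyadic_cube m (grid_index off r a) y) ->
  (\int[nu]_y (h y)%:E = \sum_(r : {ffun 'I_d -> 'I_M.+1})
    \sum_(a : {ffun 'I_d -> 'I_N.+1})
      \int[nu]_(y in dyadic_cube m (grid_index off r a)) (h y)%:E)%E.
Proof.
move=> mh h0 cover.
pose Q (r : {ffun 'I_d -> 'I_M.+1}) (a : {ffun 'I_d -> 'I_N.+1}) : set (d.-tuple R) :=
  dyadic_cube m (grid_index off r a).
have mQ r a : measurable (Q r a) by exact: measurable_dyadic_cube.
have mQh r a : measurable_fun setT (fun y => (\1_(Q r a) y * h y)%:E).
  by apply/measurable_EFinP; apply: measurable_funM => //; exact: measurable_indic.
have Qh0 r a y : (0 <= (\1_(Q r a) y * h y)%:E)%E by rewrite lee_fin mulr_ge0.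
transitivity (\int[nu]_y \sum_(r : {ffun 'I_d -> 'I_M.+1})
    \sum_(a : {ffun 'I_d -> 'I_N.+1}) (\1_(Q r a) y * h y)%:E)%E; last first.
  rewrite ge0_integral_sum//.
  - apply: eq_bigr => r _; rewrite ge0_integral_sum//.
    by apply: eq_bigr => a _; rewrite (integral_indicM nu _ (mQ r a)).
  - by move=> r; exact: emeasurable_sum.
  - by move=> r y _; exact: sume_ge0.
apply: eq_integral => y _; rewrite pair_big/=.
have [->|hy] := eqVneq (h y) 0; first by rewrite big1// => p _; rewrite mulr0.
have [r0 [a0 Qy]] := cover y hy.
rewrite (bigD1 (r0, a0))//= big1 ?adde0.
  by rewrite indicE mem_set// mul1r.
(* A cube index is the vector of floors of any of its points, so two cubes containing [y] have equal
   indices, hence equal colour and block. *)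
move=> [r a] /= /eqP ne; rewrite indicE memNset ?mul0r//= => Qy'; apply: ne.
have [] := @grid_index_inj off M N r a r0 a0; last by move=> -> ->.
apply/funext => i.
by rewrite (dyadic_cube_floor Qy') (dyadic_cube_floor Qy).
Qed.

Lemma measurable_eball x (r : R) : measurable (eball x r).
Proof.
rewrite -[X in measurable X]setTI.
rewrite (_ : eball x r = sqdist x @^-1` `]-oo, r ^+ 2[%classic).
  suff mx : measurable_fun setT (sqdist x) by apply: mx => //; exact: measurable_itv.
  rewrite /sqdist; apply: measurable_sum => i.
  by apply: measurable_funX; apply: measurable_funB => //; exact: measurable_tnth.
by apply/seteqP; split => y /=; rewrite in_itv.
Qed.

(** The ball around a cube has radius (d+1) 2^-m, which must be below 1 for (H2) to apply. *)
Lemma measure_dyadic_cube_le (nu : {measure set (d.-tuple R) -> \bar R}) (s C : R) m k :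
  (forall x r, 0 < r < 1 -> (nu (eball x r) <= (C * r `^ s)%:E)%E) ->
  d.+1%:R < (2 ^+ m : R) ->
  (nu (dyadic_cube m k) <= (C * (d.+1%:R / 2 ^+ m) `^ s)%:E)%E.
Proof.
move=> H2 dm; have r01 : 0 < (d.+1%:R / 2 ^+ m : R) < 1.
  by rewrite divr_gt0 ?exprn_gt0//= ltr_pdivrMr ?exprn_gt0// mul1r.
apply: le_trans (H2 [tuple (k i)%:~R / 2 ^+ m | i < d] _ r01); apply: le_measure.
- by rewrite inE; exact: measurable_dyadic_cube.
- by rewrite inE; exact: measurable_eball.
- exact: dyadic_cube_eball.
Qed.

End dyadic_grid.

(** * Finite unions and finite measures *)

Lemma measure_bigsetU_le {d1 : measure_display} {T : measurableType d1} {R : realType}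
    (mu : {measure set T -> \bar R}) (J : Type) (s : seq J) (E : J -> set T) :
  (forall j, measurable (E j)) ->
  (mu (\big[setU/set0]_(j <- s) E j) <= \sum_(j <- s) mu (E j))%E.
Proof.
move=> mE; elim: s => [|j s IH]; first by rewrite !big_nil measure0.
rewrite !big_cons; apply: le_trans (measureU2 _ (mE j) _) _.
  exact: bigsetU_measurable.
by rewrite leeD2l.
Qed.

Lemma mem_bigsetU {T : Type} (J : eqType) (s : seq J) (E : J -> set T) j w :
  j \in s -> E j w -> (\big[setU/set0]_(i <- s) E i) w.
Proof.
elim: s => // i s IH; rewrite inE big_cons => /predU1P[<-|js] Ew; first by left.
by right; exact: IH.
Qed.

(** Restricting [nu] to the whole space equips it with the finite-measure structure that the Tonelli
    arguments take as input, without changing any integral. *)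
Lemma finite_measure_integral {d1 : measure_display} {T : measurableType d1}
    {R : realType} (nu : {measure set T -> \bar R}) : (nu setT < +oo)%E ->
  exists fnu : {finite_measure set T -> \bar R}, forall D (h : T -> \bar R),
    measurable D -> (\int[fnu]_(x in D) h x = \int[nu]_(x in D) h x)%E.
Proof.
move=> nufin; pose fnu : {finite_measure set T -> \bar R} := mfrestr measurableT nufin.
exists fnu => D h mD; apply: eq_measure_integral => A mA _.
by rewrite /= /mfrestr /mrestr setIT.
Qed.

(** * One-step growth of the total mass of an SI-martingale *)

Section SI_step.
Context {R : realType} {d0 : measure_display} {Omega : measurableType d0}.
Context (P : probability Omega R) {d : nat} (mu : nat -> Omega -> d.-tuple R -> R).
Context (SI : SI_martingale P mu).

(** (SI3) multiplies the bound on mu_0 by at most |C| per level. Unlike (H3) this holds for every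
    outcome; it provides finiteness, not a rate. *)
Lemma SI_bounded n : exists2 M : R, 0 <= M & forall w x, mu n w x <= M.
Proof.
have [mu0 [_ [[f [muf [[M fM] _]]] [_ [C muC]]]]] := SI.
elim: n => [|n [M' M'0 IH]].
  by exists (Num.max M 0) => [|w x]; rewrite ?le_max ?lexx ?orbT// muf fM.
exists (`|C| * M') => [|w x]; first by rewrite mulr_ge0.
apply: le_trans (muC n w x) _; apply: (@le_trans _ _ (`|C| * mu n w x)).
  by rewrite ler_wpM2r// ler_norm.
by rewrite ler_wpM2l.
Qed.

(** By (SI3) zeros of mu_0 persist, so one box serves all levels and all outcomes. *)
Lemma SI_support : exists K : R, forall n w x, mu n w x != 0 ->
  forall i, `|tnth x i| <= K.
Proof.
have [mu0 [_ [[f [muf [_ [K fK]]]] [_ [C muC]]]]] := SI.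
exists K => n w x + i; rewrite leNgt; apply: contra => Ki; apply/eqP.
elim: n => [|n IH]; first by rewrite muf; apply: fK; exists i.
apply/eqP; rewrite eq_le mu0 andbT; apply: le_trans (muC n w x) _.
by rewrite IH mulr0.
Qed.

Lemma SI_mass_fin (nu : {measure set (d.-tuple R) -> \bar R}) n w D :
  (nu setT < +oo)%E -> measurable D ->
  (\int[nu]_(x in D) (mu n w x)%:E = (\int[nu]_(x in D) (mu n w x))%:E)%E.
Proof.
move=> nufin mD; have [M M0 muM] := SI_bounded n.
have [mu0 [mmu _]] := SI.
have mm : measurable_fun D (fun x => (mu n w x)%:E).
  apply/measurable_EFinP; apply: measurable_funTS.
  exact: (measurable_fun_pair2 w (mmu n)).
rewrite /Rintegral fineK// ge0_fin_numE; last first.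
  by apply: integral_ge0 => x _; rewrite lee_fin.
apply: (@le_lt_trans _ _ (\int[nu]_(x in D) (cst M%:E x))%E).
  apply: ge0_le_integral => //.
  - by move=> x _; rewrite lee_fin.
  - by move=> x _; rewrite lee_fin.
rewrite integral_cst// lte_mul_pinfty// ?lee_fin//.
by apply: le_lt_trans nufin; apply: le_measure; rewrite ?inE.
Qed.

Lemma SI_mass_measurable (nu : {measure set (d.-tuple R) -> \bar R}) n D :
  (nu setT < +oo)%E -> measurable D ->
  measurable_fun [set: Omega] (fun w => \int[nu]_(x in D) mu n w x).
Proof.
move=> nufin mD; have [mu0 [mmu _]] := SI.
have [fnu fnuE] := finite_measure_integral nufin.
apply: (@measurable_integral_param _ _ _ _ _ fnu (fun p => \1_D p.2 * mu n p.1 p.2)).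
- apply: measurable_funM; last exact: mmu.
  have m1 : measurable_fun [set: d.-tuple R] (\1_D : d.-tuple R -> R).
    exact: measurable_indic.
  exact: (measurableT_comp m1 measurable_snd).
- by move=> p; rewrite mulr_ge0.
- move=> w; rewrite -SI_mass_fin//= -(integral_indicM fnu (mu n w) mD).
  by rewrite fnuE.
Qed.

(** Here [c] is the number of colours, fixed before [n] and [nu]. A total excess above [c * u]
    forces an excess of at least [u] in some colour, and [mass_tail] bounds the probability of that
    for each colour. *)
Lemma SI_growth_tail : exists c : nat, forall n
    (nu : {measure set (d.-tuple R) -> \bar R}) (rho b q u : R),
  (nu setT < +oo)%E -> 0 <= rho -> 0 < b -> expR rho - 1 <= q * rho ->
  {ae P, forall w, forall k, \int[nu]_(x in dyadic_cube n.+1 k) mu n.+1 w x <= b} ->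
  (P [set w | (q * (\int[nu]_x mu n w x) + c%:R * u < \int[nu]_x mu n.+1 w x)%R] <=
   (c%:R * expR (- (rho * u / b)))%:E)%E.
Proof.
have [mu0 [mmu [_ [[B [filtB [adB [martB [C sepB]]]]] _]]]] := SI.
have [K suppK] := SI_support.
(* Large enough for cubes of one colour to be separated as (SI4) demands, at every level. *)
pose M := Num.bound (2 * `|C|).
have MC : 2 * `|C| <= M%:R by apply/ltW/archi_boundP; rewrite mulr_ge0.
exists #|{: {ffun 'I_d -> 'I_M.+1}}| => n nu rho b q u nufin rho0 b0 qrho Xb.
have [off [N cover]] := @grid_index_cover R d n.+1 M K.
have [sB [mB _]] := filtB n.
have [L L0 muL] := SI_bounded n.
have [fnu fnuE] := finite_measure_integral nufin.
have mQ k := @measurable_dyadic_cube R d n.+1 k.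
pose F (k : 'I_d -> int) := restr_sigma (mu n.+1) (dyadic_cube n.+1 k).
have sF k : sigma_algebra setT (F k) by exact: smallest_sigma_algebra.
have mF k : F k `<=` measurable.
  apply: smallest_sub; first exact: sigma_algebra_measurable.
  move=> _ [x [A [_ mA ->]]]; rewrite -[X in measurable X]setTI.
  exact: (measurable_fun_pair1 x (mmu n.+1)).
have Ff k x : dyadic_cube n.+1 k x -> sub_measurable (F k) (fun w => mu n.+1 w x).
  by move=> Qx A mA; apply: sub_gen_smallest; exists x, A.
have fg x : same_integrals P (B n) (fun w => mu n.+1 w x) (fun w => mu n w x).
  by move=> E BE; rewrite -!integral_indicM; [exact: martB|exact: mB..].
pose X k w := \int[nu]_(x in dyadic_cube n.+1 k) mu n.+1 w x.
pose m k w := \int[nu]_(x in dyadic_cube n.+1 k) mu n w x.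
have tail (r : {ffun 'I_d -> 'I_M.+1}) :
  (P [set w | (q * (\sum_(a : {ffun 'I_d -> 'I_N.+1}) m (grid_index off r a) w) + u <=
     \sum_(a : {ffun 'I_d -> 'I_N.+1}) X (grid_index off r a) w)%R] <=
   (expR (- (rho * u / b)))%:E)%E.
  pose s := [seq grid_index off r a | a <- enum {: {ffun 'I_d -> 'I_N.+1}}].
  have us : uniq s.
    by rewrite map_inj_uniq ?enum_uniq// => a a' /grid_index_inj[].
  have sumE (h : ('I_d -> int) -> R) : \sum_(k <- s) h k =
      \sum_(a : {ffun 'I_d -> 'I_N.+1}) h (grid_index off r a).
    by rewrite big_map big_enum.
  have Ks k : k \in s -> [set k | exists a, k = @grid_index d off M N r a] k.
    by move=> /mapP[a _ ->]; exists a.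
  have cond := sepB n _ (@grid_index_separated R d off M N r C n MC).
  have := @mass_tail _ _ _ _ R P _ fnu (B n) F _ sB mB sF mF cond
    (dyadic_cube n.+1) mQ (fun p => mu n.+1 p.1 p.2) (fun p => mu n p.1 p.2)
    (mmu n.+1) (mmu n) (fun p => mu0 _ _ _) (fun p => mu0 _ _ _) Ff (adB n) fg X m
    _ _ L L0 (fun p => muL _ _) rho b q u s rho0 b0 qrho us Ks.
  move=> H.
  rewrite (_ : [set w | _] = [set w | (q * (\sum_(k <- s) m k w) + u <=
     \sum_(k <- s) X k w)%R]).
    apply: H.
    - by move=> k w; rewrite fnuE// SI_mass_fin.
    - by move=> k w; rewrite fnuE// SI_mass_fin.
    - by move: Xb; apply: filterS => w Xb k _; exact: Xb.
  by apply/seteqP; split => w /=; rewrite !sumE.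
pose E (r : {ffun 'I_d -> 'I_M.+1}) := [set w | (q * (\sum_(a : {ffun 'I_d -> 'I_N.+1})
  m (grid_index off r a) w) + u <=
     \sum_(a : {ffun 'I_d -> 'I_N.+1}) X (grid_index off r a) w)%R].
have mE r : measurable (E r).
  rewrite -[E r]setTI; apply: measurable_fun_le => //.
    apply: measurable_funD => //; apply: measurable_funM => //.
    by apply: measurable_sum => a; exact: SI_mass_measurable.
  by apply: measurable_sum => a; exact: SI_mass_measurable.
have split_mass j w : (forall x, mu j w x != 0 -> forall i, `|tnth x i| <= K) ->
  \int[nu]_x mu j w x = \sum_(r : {ffun 'I_d -> 'I_M.+1})
    \sum_(a : {ffun 'I_d -> 'I_N.+1})
      \int[nu]_(x in dyadic_cube n.+1 (grid_index off r a)) mu j w x.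
  move=> supp; apply: EFin_inj; rewrite -SI_mass_fin//.
  rewrite (integral_dyadic_grid nu (m := n.+1) (off := off) (M := M) (N := N)) //.
  - rewrite -sumEFin; apply: eq_bigr => r _; rewrite -sumEFin.
    by apply: eq_bigr => a _; rewrite SI_mass_fin.
  - exact: (measurable_fun_pair2 w (mmu j)).
  - by move=> x /supp; exact: cover.
apply: (@le_trans _ _ (P (\big[setU/set0]_(r <- enum {: {ffun 'I_d -> 'I_M.+1}}) E r))).
  apply: le_measure; rewrite ?inE.
  - rewrite (_ : [set w | _] = ~` [set w | (\int[nu]_x mu n.+1 w x <=
        q * (\int[nu]_x mu n w x) + #|{: {ffun 'I_d -> 'I_M.+1}}|%:R * u)%R]); last first.
      by apply/seteqP; split => w /=; [move=> + ?; rewrite ltNge => /negP|move=> /negP; rewrite -ltNge].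
    apply: measurableC; rewrite -[X in measurable X]setTI.
    apply: measurable_fun_le => //; first exact: SI_mass_measurable.
    by apply: measurable_funD => //; apply: measurable_funM => //; exact: SI_mass_measurable.
  - by apply: bigsetU_measurable => r _; exact: mE.
  (* Pigeonhole by contraposition: summing the failed inequalities over all colours bounds the total
     mass. *)
  move=> w /=; apply: contraPP => Ew.
  apply/negP; rewrite -leNgt !split_mass; try by move=> x; exact: suppK.
  rewrite mulr_sumr mulr_natl -sumr_const -big_split/=; apply: ler_sum => r _.
  rewrite leNgt; apply/negP => /ltW Er; apply: Ew.
  exact: (mem_bigsetU (mem_enum _ r)).
apply: le_trans (measure_bigsetU_le P _ mE) _.
apply: (@le_trans _ _ (\sum_(r <- enum {: {ffun 'I_d -> 'I_M.+1}})
  (expR (- (rho * u / b)))%:E)%E).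
  by apply: lee_sum => r _; exact: tail.
by rewrite sumEFin lee_fin big_enum/= sumr_const mulr_natl.
Qed.

End SI_step.

(** * Numerical estimates, the deterministic recursion and Borel-Cantelli *)

Lemma expR_sub1_le {R : realType} (q : R) : 1 < q ->
  expR (1 - q^-1) - 1 <= q * (1 - q^-1).
Proof.
move=> q1; have q0 : 0 < q by exact: lt_trans q1.
rewrite mulrBr mulr1 divff ?gt_eqF// lerD2r.
(* The claim is now [expR rho <= q] for [rho = 1 - q^-1], that is [q^-1 <= expR (- rho)], an
   instance of 1 + x <= exp x. *)
rewrite -[1 - q^-1]opprK expRN -[leRHS]invrK lef_pV2 ?posrE ?invr_gt0 ?expR_gt0//.
by apply: le_trans (expR_ge1Dx _); rewrite opprB addrC subrK.
Qed.

(** The left side is the density bound (H3) times the bound from (H2) for a cube of side 2^-m; the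
    right side isolates its exponential rate in [m]. *)
Lemma powR_scale {R : realType} (a s C : R) (d m : nat) : 0 < C ->
  C * 2 `^ (a * m%:R) * (C * (d.+1%:R / 2 ^+ m) `^ s) =
  C * C * d.+1%:R `^ s * (2 `^ (a - s)) ^+ m.
Proof.
move=> C0; rewrite powRM// ?invr_ge0//.
rewrite -!powR_mulrn ?powR_ge0// -powRN -!powRrM mulrBl powRB.
  by rewrite mulNr powRN (mulrC m%:R); ring.
by rewrite pnatr_eq0 implybT.
Qed.

Lemma recursion_bounded {R : realType} {G : Type} (y : nat -> G -> R) (q v D : R) N :
  0 <= q -> 1 < v -> q < v -> 0 <= D ->
  (forall n, exists A, forall t, y n t <= A) ->
  (forall n, (N <= n)%N -> forall S, (forall t, y n t <= S) ->
     forall t, y n.+1 t <= q * S + D * v ^+ n.+1) ->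
  exists A, forall n t, y n t <= A * v ^+ n.
Proof.
move=> q0 v1 qv D0 fin rec; have v0 : 0 < v by apply: lt_trans v1.
have [A [A0 AN]] : exists A, 0 <= A /\ forall n, (n <= N)%N -> forall t, y n t <= A * v ^+ n.
  elim: N {rec} => [|N [A [A0 IH]]].
    have [A HA] := fin 0%N; exists `|A|; split => // -[|//] _ t.
    by rewrite expr0 mulr1 (le_trans (HA t))// ler_norm.
  have [B HB] := fin N.+1; exists (A + `|B|); split; first by rewrite addr_ge0.
  move=> n; rewrite leq_eqVlt => /predU1P[->|nN] t.
    apply: le_trans (HB t) _; apply: (@le_trans _ _ (A + `|B|)).
      by rewrite (le_trans (ler_norm _))// lerDr.
    by rewrite ler_peMr ?addr_ge0// exprn_ege1// ltW.
  by apply: le_trans (IH n nN t) _; rewrite ler_wpM2r ?exprn_ge0 ?(ltW v0)// lerDl.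
(* The fixed point of the recursion: [q * B + D * v = B * v], so the bound with constant [A + B]
   reproduces itself when [q < v]. *)
pose B := D * v / (v - q).
have B0 : 0 <= B by rewrite divr_ge0 ?subr_ge0 ?mulr_ge0 ?(ltW v0) ?(ltW qv).
have BE : B * (v - q) = D * v by rewrite /B divfK// gt_eqF// subr_gt0.
exists (A + B) => n t.
have [nN|/ltnW Nn] := leqP n N.
  apply: le_trans (AN n nN t) _.
  by rewrite ler_wpM2r ?exprn_ge0 ?(ltW v0)// lerDl.
rewrite -(subnKC Nn) in t *; elim: (n - N)%N t => [|k IH] t.
  rewrite addn0; apply: le_trans (AN N (leqnn N) t) _.
  by rewrite ler_wpM2r ?exprn_ge0 ?(ltW v0)// lerDl.
rewrite addnS; apply: le_trans (rec _ (leq_addr _ _) _ IH t) _.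
rewrite exprS mulrA (mulrA D) mulrA -mulrDl ler_wpM2r ?exprn_ge0 ?(ltW v0)//.
by rewrite -BE; have := mulr_ge0 A0 (ltW (_ : 0 < v - q)); rewrite subr_gt0 => /(_ qv); lra.
Qed.

Lemma geometric_nneseries_lty {R : realType} (a k : R) (u : nat -> \bar R) :
  0 <= k < 1 -> (forall n, (0 <= u n)%E) -> (forall n, (u n <= (a * k ^+ n)%:E)%E) ->
  (\sum_(n <oo) u n < +oo)%E.
Proof.
move=> /andP[k0 k1] u0 uk.
apply: (@le_lt_trans _ _ (\sum_(n <oo) (a * k ^+ n)%:E)%E).
  by apply: lee_nneseries => n *; [exact: u0|exact: uk].
rewrite (_ : (\sum_(n <oo) _)%E = (limn (series (geometric a k)))%:E) ?ltry//.
rewrite -EFin_lim; last by apply: is_cvg_geometric_series; rewrite ger0_norm.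
congr (limn _); apply/funext => n /=; rewrite /series/= -sumEFin.
by apply: eq_bigr.
Qed.

(* The maximum over z of (A + 1) z - B z ^ 2 is (A + 1) ^ 2 / (4 B). *)
Lemma expR_quadratic_decay {R : realType} (A B z : R) : 0 < B -> 0 < z ->
  expR (A * z - B * z ^+ 2) <= expR ((A + 1) ^+ 2 / (4 * B)) * z^-1.
Proof.
move=> B0 z0; apply: (@le_trans _ _ (expR ((A + 1) ^+ 2 / (4 * B)) * expR (- z))).
  rewrite -expRD ler_expR -lerBlDr ler_pdivlMr ?mulr_gt0//.
  by have := sqr_ge0 (2 * B * z - (A + 1)); rewrite !expr2; lra.
rewrite ler_wpM2l ?expR_ge0// expRN lef_pV2 ?posrE ?expR_gt0//.
by apply: le_trans (expR_ge1Dx _); rewrite lerDr.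
Qed.

Lemma powR2_gt1 {R : realType} (r : R) : 0 < r -> 1 < 2 `^ r.
Proof.
move=> r0; have := @gt0_ltr_powR R r r0 1 2.
by rewrite powR1; apply; rewrite ?nnegrE// ltr1n.
Qed.

Lemma borel_cantelli_ae {d1 : measure_display} {T : measurableType d1} {R : realType}
    (P : probability T R) (F : (set T)^nat) :
  (forall n, measurable (F n)) -> (\sum_(n <oo) P (F n) < +oo)%E ->
  {ae P, forall w, exists N, forall n, (N <= n)%N -> ~ F n w}.
Proof.
move=> mF sF; exists (lim_sup_set F); split.
- apply: bigcap_measurable => [|n _]; first by exists 0%N.
  by apply: bigcup_measurable => k _; exact: mF.
- exact: lim_sup_set_cvg0.
- move=> w /= H n _; apply: contrapT => Hn; apply: H; exists n => k nk Fk.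
  by apply: Hn; exists k.
Qed.

(** * Mass bounds derived from (H2) *)

Lemma SI_cube_mass_le {R : realType} {d0 : measure_display} {Omega : measurableType d0}
    (P : probability Omega R) {d : nat} (mu : nat -> Omega -> d.-tuple R -> R)
    (nu : {measure set (d.-tuple R) -> \bar R}) (s C B : R) n m w k :
  SI_martingale P mu -> (nu setT < +oo)%E -> 0 <= B ->
  (forall x r, 0 < r < 1 -> (nu (eball x r) <= (C * r `^ s)%:E)%E) ->
  (forall x, mu n w x <= B) -> d.+1%:R < (2 ^+ m : R) ->
  \int[nu]_(x in dyadic_cube m k) mu n w x <= B * (C * (d.+1%:R / 2 ^+ m) `^ s).
Proof.
move=> SI nufin B0 H2 muB dn; have [mu0 [mmu _]] := SI.
have mQ := @measurable_dyadic_cube R d m k.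
rewrite -lee_fin -(SI_mass_fin SI)//.
apply: (@le_trans _ _ (\int[nu]_(x in dyadic_cube m k) (cst B%:E x))%E).
  apply: ge0_le_integral => //.
  - by move=> x _; rewrite lee_fin.
  - apply/measurable_EFinP; apply: measurable_funTS.
    exact: (measurable_fun_pair2 w (mmu n)).
  - by move=> x _; rewrite lee_fin.
rewrite integral_cst// EFinM; apply: lee_wpmul2l; first by rewrite lee_fin.
exact: measure_dyadic_cube_le.
Qed.

(** The bound must be uniform in the measure, whose total mass is only assumed finite; it comes from
    covering the common support by finitely many cubes and applying (H2) to each. *)
Lemma SI_mass_bounded {R : realType} {d0 : measure_display} {Omega : measurableType d0}
    (P : probability Omega R) {d : nat} (mu : nat -> Omega -> d.-tuple R -> R)
    (s C : R) n : SI_martingale P mu ->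
  exists A, forall (nu : {measure set (d.-tuple R) -> \bar R}) w,
    (nu setT < +oo)%E ->
    (forall x r, 0 < r < 1 -> (nu (eball x r) <= (C * r `^ s)%:E)%E) ->
    \int[nu]_x mu n w x <= A.
Proof.
move=> SI; have [L L0 muL] := SI_bounded SI n.
have [K suppK] := SI_support SI.
have [mu0 [mmu _]] := SI.
(* Level d+1 is fine enough because d+1 < 2^(d+1); a single colour ([M] equal to 0) suffices for a
   covering. *)
have [off [N cover]] := @grid_index_cover R d d.+1 0 K.
exists (\sum_(r : {ffun 'I_d -> 'I_1}) \sum_(a : {ffun 'I_d -> 'I_N.+1})
  (L * (C * (d.+1%:R / 2 ^+ d.+1) `^ s))) => nu w nufin H2.
rewrite -lee_fin -(SI_mass_fin SI)//.
rewrite (integral_dyadic_grid nu (m := d.+1) (off := off) (M := 0) (N := N)) //; first last.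
- by move=> x /suppK; exact: cover.
- exact: (measurable_fun_pair2 w (mmu n)).
rewrite -sumEFin; apply: lee_sum => r _; rewrite -sumEFin; apply: lee_sum => a _.
rewrite (SI_mass_fin SI)//; last exact: measurable_dyadic_cube.
rewrite lee_fin; apply: (SI_cube_mass_le _ SI) => //.
by rewrite -natrX ltr_nat ltn_expl.
Qed.

(** * Choice of constants, the exceptional events and the final recursion *)

Theorem theorem4p4 (R : realType) (d0 : measure_display) (Omega : measurableType d0)
  (P : probability Omega R) (d : nat) (mu : nat -> Omega -> d.-tuple R -> R)
  (Gamma : pseudoMetricType R) (eta : Gamma -> {measure set (d.-tuple R) -> \bar R})
  (s alpha C theta : R) :
  SI_martingale P mu ->
  hausdorff_space Gamma -> totally_bounded Gamma ->
  (forall t, (eta t setT < +oo)%E) ->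
  0 < s -> 0 < alpha -> 0 < C ->
  (* (H2) *)
  (forall x t r, 0 < r < 1 -> (eta t (eball x r) <= (C * r `^ s)%:E)%E) ->
  (* (H3) *)
  {ae P, forall w, forall n x, mu n w x <= C * 2 `^ (alpha * n%:R)} ->
  (* (H5) *)
  0 < theta ->
  (forall xi : R, 0 < xi ->
     exists Cxi : R, exists Gn : nat -> seq Gamma,
     exists eps : nat -> R, exists N0 : Omega -> nat,
       (forall n, (size (Gn n))%:R <= expR (Cxi * 2 `^ (n%:R * xi))) /\
       (fun n => eps n / 2 `^ (theta * n%:R)) @ \oo --> (0 : R) /\
       {ae P, forall w, forall n, (N0 w <= n)%N ->
          (ereal_sup [set (\int[eta t]_x (mu n w x)%:E)%E | t in [set: Gamma]] <=
           ereal_sup [set (\int[eta t]_x (mu n w x)%:E)%E | t in [set` Gn n]]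
             + (eps n)%:E)%E}) ->
  0 <= alpha - s < theta ->
  {ae P, forall w,
     (ereal_sup [set z | exists n t,
        z = ((2 `^ (- (theta * n%:R)))%:E * \int[eta t]_x (mu n w x)%:E)%E] < +oo)%E}.
Proof.
move=> SI _ _ etafin s0 alpha0 C0 H2 H3 theta0 H5 /andP[_ lt_theta].
have H2t t x r := H2 x t r.
pose Y n t w := \int[eta t]_x mu n w x.
have YE n t w : (\int[eta t]_x (mu n w x)%:E = (Y n t w)%:E)%E.
  by rewrite (SI_mass_fin SI).
pose v : R := 2 `^ theta.
have v1 : 1 < v by exact: powR2_gt1.
have v0 : 0 < v by exact: lt_trans v1.
have vE n : 2 `^ (theta * n%:R) = v ^+ n by rewrite powRrM powR_mulrn// powR_ge0.
(* Any [q] strictly between 1 and [v] would do; this [rho] satisfies [expR rho - 1 <= q * rho]. *)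
pose q := (1 + v) / 2; pose rho := 1 - q^-1.
have q1 : 1 < q by rewrite /q ltr_pdivlMr//; lra.
have qv : q < v by rewrite /q ltr_pdivrMr//; lra.
have q0 : 0 < q by exact: lt_trans q1.
have rho0 : 0 < rho by rewrite subr_gt0 invf_lt1.
(* Half the available gap, so that [v = z ^+ 2 * l] below: the tail exponent grows like z^(2n),
   while the logarithm of the size of [Gn n] grows only like z^n. *)
pose xi := (theta - (alpha - s)) / 2.
have xi0 : 0 < xi by rewrite divr_gt0// subr_gt0.
have [Cxi [Gn [eps [N0 [sizeG [eps0 supG]]]]]] := H5 xi xi0.
have [c tail] := SI_growth_tail SI.
pose z : R := 2 `^ xi.
have z1 : 1 < z by exact: powR2_gt1.
have z0 : 0 < z by exact: lt_trans z1.
have zE n : 2 `^ (n%:R * xi) = z ^+ n.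
  by rewrite mulrC powRrM powR_mulrn// powR_ge0.
pose l : R := 2 `^ (alpha - s); have l0 : 0 < l by exact: powR_gt0.
have vzl : v = z ^+ 2 * l.
  rewrite /v /z /l -powR_mulrn ?powR_ge0// -powRrM -powRD; last first.
    by rewrite pnatr_eq0 implybT.
  by congr (2 `^ _); rewrite /xi; field.
pose c0 : R := C * C * d.+1%:R `^ s.
have c00 : 0 < c0 by rewrite !mulr_gt0// powR_gt0.
(* The index set is that of level n+1, where (H5) is applied, although the event compares level n+1
   with level n. *)
pose Bad n := \big[setU/set0]_(t <- Gn n.+1)
  [set w | (q * Y n t w + c%:R * v ^+ n.+1 < Y n.+1 t w)%R].
have mY n t : measurable_fun [set: Omega] (Y n t).
  by apply: (SI_mass_measurable SI) => //; exact: etafin.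
have mGrow n t : measurable [set w | (q * Y n t w + c%:R * v ^+ n.+1 < Y n.+1 t w)%R].
  rewrite (_ : [set w | _] = ~` [set w | (Y n.+1 t w <=
      q * Y n t w + c%:R * v ^+ n.+1)%R]); last first.
    by apply/seteqP; split => w /=; [move=> + ?; rewrite ltNge => /negP|move=> /negP; rewrite -ltNge].
  apply: measurableC; rewrite -[X in measurable X]setTI.
  apply: measurable_fun_le => //.
  apply: measurable_funD => //; apply: measurable_funM => //; exact: mY.
have mBad n : measurable (Bad n) by exact: bigsetU_measurable.
pose E := expR ((Cxi + 1) ^+ 2 / (4 * (rho / c0))).
have tailBad n : (d.+1 <= n)%N -> (P (Bad n) <= (c%:R * (E * (z ^+ n.+1)^-1))%:E)%E.
  move=> dn; apply: le_trans (measure_bigsetU_le P _ (mGrow n)) _.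
  have dn' : d.+1%:R < (2 ^+ n.+1 : R).
    by rewrite -natrX ltr_nat (leq_ltn_trans dn)// (ltn_trans (ltnSn n))// ltn_expl.
  have tailt t : (P [set w | (q * Y n t w + c%:R * v ^+ n.+1 < Y n.+1 t w)%R] <=
      (c%:R * expR (- (rho / c0 * (z ^+ n.+1) ^+ 2)))%:E)%E.
    (* The exponent [rho * u / b] with [u = v ^+ n.+1] and with [b = c0 * l ^+ n.+1], the almost
       sure bound on the mass of a cube. *)
    have -> : rho / c0 * (z ^+ n.+1) ^+ 2 = rho * v ^+ n.+1 / (c0 * l ^+ n.+1).
      rewrite vzl exprMn exprAC; field.
      by rewrite expf_neq0 ?gt_eqF// gt_eqF.
    apply: tail => //.
    - exact: ltW.
    - by rewrite mulr_gt0// exprn_gt0.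
    - exact: expR_sub1_le.
    move: H3; apply: filterS => w muC k.
    rewrite -(powR_scale alpha s d n.+1 C0).
    apply: (SI_cube_mass_le _ SI) => //; last exact: H2t.
    by rewrite mulr_ge0 ?(ltW C0)// powR_ge0.
  apply: (@le_trans _ _ (\sum_(t <- Gn n.+1)
      (c%:R * expR (- (rho / c0 * (z ^+ n.+1) ^+ 2)))%:E)%E).
    by apply: lee_sum => t _; exact: tailt.
  rewrite sumEFin lee_fin big_const_seq count_predT iter_addr_0.
  rewrite -[leLHS]mulr_natl [leLHS]mulrCA ler_wpM2l//.
  (* Cardinality times tail is at most exp(A x - B x^2) with x = z^(n+1), and its decay like 1/x is
     already summable. *)
  apply: le_trans (expR_quadratic_decay Cxi _ (exprn_gt0 _ z0)); last by rewrite divr_gt0.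
  by rewrite expRD ler_wpM2r ?expR_ge0// -zE.
have zV : 0 <= z^-1 < 1 by rewrite invr_ge0 (ltW z0) invf_lt1.
have BC : {ae P, forall w, exists N, forall n, (N <= n)%N -> ~ Bad (d.+1 + n)%N w}.
  apply: borel_cantelli_ae => [n|]; first exact: mBad.
  apply: (geometric_nneseries_lty (a := c%:R * (E * z^-1 ^+ d.+2)) zV) => [n|n].
    exact: measure_ge0.
  apply: le_trans (tailBad _ (leq_addr _ _)) _.
  by rewrite lee_fin -exprVn -addSn exprD !mulrA.
move/cvgrPdist_le : eps0 => /(_ 1 ltr01)[N2 _ epsN2].
have epsv n : (N2 <= n)%N -> eps n <= v ^+ n.
  move=> /epsN2 /=; rewrite sub0r normrN vE => /(le_trans (ler_norm _)).
  by rewrite ler_pdivrMr ?exprn_gt0// mul1r.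
move: BC supG; apply: filterS2 => w [N1 notBad] supGw.
have [A YA] : exists A, forall n t, Y n t w <= A * v ^+ n.
  (* In the constant [c%:R + 1], the [c] comes from the one-step growth and the 1 from the error
     term of (H5), eventually at most [v ^+ n]. *)
  apply: (@recursion_bounded _ _ (fun n t => Y n t w) q v (c%:R + 1)
    (maxn (d.+1 + N1) (maxn (N0 w) N2))) => //.
  - exact: ltW.
  - move=> n; have [A HA] := SI_mass_bounded s C n SI.
    by exists A => t; apply: HA => //; exact: H2t.
  move=> n; rewrite !geq_max => /and3P[dn N0n N2n] S YS t.
  have := supGw n.+1 (leqW N0n) => supn.
  rewrite -lee_fin -YE.
  have : ((\int[eta t]_x (mu n.+1 w x)%:E) <= ereal_sup
      [set (\int[eta t]_x (mu n.+1 w x)%:E)%E | t in [set: Gamma]])%E.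
    by apply: ereal_sup_ubound; exists t.
  move=> /le_trans; apply; apply: le_trans supn _.
  have -> : ((q * S + (c%:R + 1) * v ^+ n.+1)%:E =
      (q * S + c%:R * v ^+ n.+1)%:E + (v ^+ n.+1)%:E)%E.
    by rewrite -EFinD mulrDl mul1r addrA.
  apply: leeD; last by rewrite lee_fin epsv// leqW.
  (* Only indices in [Gn n.+1] remain, and for these a larger growth would put [w] in [Bad n]. *)
  apply: ge_ereal_sup => _ [t' Gt' <-]; rewrite YE lee_fin.
  apply: (@le_trans _ _ (q * Y n t' w + c%:R * v ^+ n.+1)); last first.
    by rewrite lerD2r ler_wpM2l ?(ltW q0).
  rewrite leNgt; apply/negP => grow.
  have : ~ Bad n w.
    rewrite -(subnKC (leq_trans (leq_addr _ _) dn)); apply: notBad.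
    by rewrite leq_subRL// (leq_trans (leq_addr _ _) dn).
  by apply; exact: (mem_bigsetU Gt').
apply: (@le_lt_trans _ _ A%:E); last exact: ltry.
apply: ge_ereal_sup => _ [n [t ->]].
by rewrite YE -EFinM lee_fin powRN vE mulrC ler_pdivrMr ?exprn_gt0//.
Qed.
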